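(* Let $p$ be a rational prime with $p\equiv 7$ or $9 \pmod{16}$, and let $n$ be an integer with $n\ge 3$ if $p\equiv 7\pmod{16}$ and $n\ge 2$ if $p\equiv 9\pmod{16}$. Let $\mathfrak{p}$ be a prime ideal of $\mathbb{Z}[\zeta_{2^{n+1}}]$ lying over $p$. Let $(a_p,b_p)$ be the solution of $a^2-2b^2=p$ in positive integers with $a_p$ minimal. Then $$\lambda_1\big(\Sigma_{\mathbb{Q}(\zeta_{2^{n+1}})}(\mathfrak{p})\big)=\sqrt{2^n a_p}.$$ Moreover, $\lambda_1\big(\Sigma_{\mathbb{Q}(\zeta_{2^{n+1}})}(\mathfrak{p})\big)$ is bounded above by $\sqrt[4]{2^{2n+1}p}$, and $\sqrt[4]{2^{2n+1}p}<2^n\sqrt[4]{p}$ (the latter being the upper bound given by Minkowski's theorem).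
   Context: $\zeta_m=e^{2\pi i/m}$. For a number field $\mathbb{K}$ of degree $t$ with complex embeddings $\varphi_1,\dots,\varphi_t$ (all of them, including both members of each complex-conjugate pair), the canonical embedding is $\Sigma_{\mathbb{K}}(x)=(\varphi_1(x),\dots,\varphi_t(x))$ with Euclidean norm $\|\Sigma_{\mathbb{K}}(x)\|^2=\sum_{j=1}^t|\varphi_j(x)|^2$. For a nonzero ideal $I$ of the ring of integers, $\lambda_1(\Sigma_{\mathbb{K}}(I))=\min_{0\ne x\in I}\|\Sigma_{\mathbb{K}}(x)\|$ is the length of a shortest nonzero vector of the ideal lattice. *)

(* Defs.v *)
From HB Require Import structures.
From mathcomp Require Import all_boot all_order all_algebra all_field.
Set Implicit Arguments. Unset Strict Implicit. Unset Printing Implicit Defensive.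
Import Order.TTheory GRing.Theory Num.Theory.
Local Open Scope ring_scope.

(* Everything lives inside algC (the algebraic complex numbers).
   [z] is a primitive m-th root of unity (m = 2^(n+1)); the ring of integers
   of Q(z) is Z[z]. *)

Definition pev (q : {poly int}) (x : algC) : algC :=
  (map_poly (fun c : int => c%:~R) q).[x].

Definition inZz (z x : algC) : Prop := exists q : {poly int}, x = pev q z.

Definition is_ideal (z : algC) (I : algC -> Prop) : Prop :=
  [/\ forall x, I x -> inZz z x,
      I 0,
      forall x y, I x -> I y -> I (x + y)
    & forall r x, inZz z r -> I x -> I (r * x)].

Definition is_prime_ideal (z : algC) (I : algC -> Prop) : Prop :=
  [/\ is_ideal z I, ~ I 1
    & forall x y, inZz z x -> inZz z y -> I (x * y) -> I x \/ I y].

Definition lies_over (I : algC -> Prop) (p : nat) : Prop :=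
  forall a : int, I a%:~R <-> (p%:Z %| a)%Z.

(* The complex embeddings of Q(z), z a primitive m-th root of unity, are
   q(z) |-> q(z^k) for k in [0,m) coprime to m.  Euclidean norm of the
   canonical embedding of the element q(z) : *)
Definition emb_norm (m : nat) (z : algC) (q : {poly int}) : algC :=
  sqrtC (\sum_(k < m | coprime k m) `|pev q (z ^+ k)| ^+ 2).

Definition is_lambda1 (m : nat) (z : algC) (I : algC -> Prop) (l : algC) : Prop :=
  (exists q : {poly int}, [/\ I (pev q z), pev q z != 0 & emb_norm m z q = l])
  /\ (forall q : {poly int}, I (pev q z) -> pev q z != 0 -> l <= emb_norm m z q).

(* Main.v *)
Require Import Defs.
From HB Require Import structures.
From mathcomp Require Import all_boot all_order all_algebra all_field.
From mathcomp Require Import perm zify ring.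
Import Order.TTheory GRing.Theory Num.Theory.
Local Open Scope ring_scope.

(* Let w be the primitive 8th root of unity among the powers of z, s = w + 1/w a
   square root of 2 and q(z) in P.  The Frobenius congruence q(z^p) = q(z)^p mod p
   shows that P is stable under z |-> z^p, and together with complex conjugation this
   map generates all z |-> z^k with k = 1 or -1 mod 8.  Hence the sum of |q(z^k)|^2 over
   these k lies in P; it also lies in Z[s] and is 2^(n-1) (A + B s), while the squared
   norm of q(z) is 2^n A.  So p divides A^2 - 2 B^2, which is positive.  If the quotient is
   1 then A >= a_p by minimality of a_p, and otherwise A^2 >= 2 p >= a_p^2.

   Conversely P contains a lattice of index p in the ring of integers of the
   decomposition field of p, which has degree 4: this field is Q(w) if p = 9 mod 16, and
   Q(v - 1/v) with v^2 = w if p = 7 mod 16.  Hermite's inequality gives there some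
   x <> 0 with |x|^2 = A + B s and A^2 < 7 p, so A^2 - 2 B^2 = k p with 0 < k < 7.  As 3
   and 5 are inert in Z[s], k is a power of 2, and dividing x by the prime above 2
   makes k = 1.  Multiplying by units of Z[s] achieves A^2 <= 2 p, and the solution of
   A^2 - 2 B^2 = p with A^2 <= 2 p is unique, so that A = a_p. *)

Set Implicit Arguments. Unset Strict Implicit. Unset Printing Implicit Defensive.

(** * Hermite's inequality for integral forms *)

Definition qform k (G : 'M[int]_k) (v : 'rV[int]_k) : int := (v *m G *m v^T) 0 0.

Definition posdef k (G : 'M[int]_k) : Prop :=
  G^T = G /\ forall v, v != 0 -> 0 < qform G v.

Lemma qform_congr k (G U : 'M[int]_k) (v : 'rV_k) :
  qform (U *m G *m U^T) v = qform G (v *m U).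
Proof. by rewrite /qform trmx_mul !mulmxA. Qed.

Lemma qform_delta k (G : 'M[int]_k) i : qform G (delta_mx 0 i) = G i i.
Proof. by rewrite /qform trmx_delta -rowE -colE !mxE. Qed.

Lemma posdef_congr k (G U : 'M[int]_k) :
  \det U != 0 -> posdef G -> posdef (U *m G *m U^T).
Proof.
move=> dU [sG pG]; split; first by rewrite !trmx_mul trmxK sG mulmxA.
move=> v v0; rewrite qform_congr; apply: pG.
apply: contra_neq v0 => vU; apply/eqP.
have /eqP := congr1 (mulmx^~ (\adj U)) vU.
by rewrite -mulmxA mul_mx_adj mul0mx mul_mx_scalar scalemx_eq0 (negPf dU).
Qed.

Lemma det_congr k (G U : 'M[int]_k) : \det (U *m G *m U^T) = \det U ^+ 2 * \det G.
Proof. by rewrite !det_mulmx det_tr expr2; ring. Qed.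

Lemma unimodular_det k (U : 'M[int]_k) :
  U \in unitmx -> \det U != 0 /\ \det U ^+ 2 = 1.
Proof.
move=> uU; have /orP[/eqP->|/eqP->] : (\det U == 1) || (\det U == -1) by [].
  by rewrite expr1n.
by rewrite sqrrN expr1n.
Qed.

Section Schur.
Variables (k : nat) (G : 'M[int]_(1 + k)).

(* Schur complement of the upper left entry, multiplied by that entry to stay integral. *)
Definition schur : 'M[int]_k :=
  ulsubmx G 0 0 *: drsubmx G - dlsubmx G *m ursubmx G.

(** Left multiplication by the block matrix with rows (1, 0) and (-[dlsubmx G], [M]) clears the
    lower left block of [G]. *)
Lemma det_schur :
  ulsubmx G 0 0 ^+ k * \det G = ulsubmx G 0 0 * \det schur.
Proof.
set M := ulsubmx G 0 0.
have -> : M ^+ k = \det (block_mx 1%:M 0 (- dlsubmx G) (M%:M : 'M_k)).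
  by rewrite det_lblock det1 det_scalar mul1r.
rewrite -det_mulmx -{2}(submxK G) mulmx_block !mul1mx !mul0mx !addr0.
have ulE : ulsubmx G = M%:M by rewrite [LHS]mx11_scalar.
rewrite ulE !mulNmx mul_mx_scalar !mul_scalar_mx addNr det_ublock det_scalar1.
by rewrite addrC.
Qed.

Hypothesis sG : G^T = G.

(** Completion of the square in the first coordinate. *)
Lemma qform_block (a : int) (v : 'rV_k) :
  ulsubmx G 0 0 * qform G (row_mx a%:M v) =
  (ulsubmx G 0 0 * a + (v *m dlsubmx G) 0 0) ^+ 2 + qform schur v.
Proof.
rewrite /schur; set M := ulsubmx G 0 0; set t := (v *m dlsubmx G) 0 0.
have ulE : ulsubmx G = M%:M by rewrite [LHS]mx11_scalar.
have urE : ursubmx G = (dlsubmx G)^T by rewrite trmx_dlsub sG.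
have GE : G = block_mx M%:M (dlsubmx G)^T (dlsubmx G) (drsubmx G).
  by rewrite -ulE -urE submxK.
have tE : v *m dlsubmx G = t%:M by rewrite [LHS]mx11_scalar.
have tE' : (dlsubmx G)^T *m v^T = t%:M by rewrite -trmx_mul tE tr_scalar_mx.
rewrite /qform [X in row_mx _ _ *m X]GE mul_row_block tr_row_mx mul_row_col.
rewrite urE tr_scalar_mx tE.
rewrite !mulmxDl -(mulmxA _ (dlsubmx G)^T) tE' -!scalar_mxM.
rewrite mulmxBr mulmxBl mulmxA tE -scalemxAr -scalemxAl -(mulmxA _ (dlsubmx G)^T) tE'.
rewrite -!scalar_mxM !mxE /= !mulr1n.
set e := (\sum_ _ _); ring.
Qed.

End Schur.

Lemma posdef_schur k (G : 'M[int]_(1 + k)) : posdef G ->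
  0 < ulsubmx G 0 0 /\ posdef (schur G).
Proof.
move=> [sG pG].
have M0 : 0 < ulsubmx G 0 0.
  have := pG (delta_mx 0 (lshift k 0)); rewrite qform_delta !mxE; apply.
  apply/eqP=> /matrixP /(_ 0 (lshift k 0)); rewrite !mxE !eqxx //.
split=> //; split.
  rewrite /schur linearB linearZ /= trmx_mul trmx_drsub trmx_ursub trmx_dlsub !sG.
  by [].
move=> v v0.
set M := ulsubmx G 0 0 in M0 *; set t := (v *m dlsubmx G) 0 0.
(* With first coordinate [- t] in front of [M *: v], the square in [qform_block] vanishes. *)
have := @qform_block _ G sG (- t) (M *: v); rewrite -/M.
have -> : (M *: v *m dlsubmx G) 0 0 = M * t by rewrite -scalemxAl mxE.
have -> : qform (schur G) (M *: v) = M ^+ 2 * qform (schur G) v.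
  by rewrite /qform linearZ /= -!scalemxAl -scalemxAr !mxE mulrA expr2.
rewrite mulrN addNr expr0n add0r => E.
have : 0 < M * qform G (row_mx (- t)%:M (M *: v)).
  rewrite mulr_gt0 // pG //; apply: contra_neq v0 => /eqP.
  rewrite row_mx_eq0 => /andP [_]; rewrite scalemx_eq0 => /orP [|/eqP //].
  by rewrite gt_eqF.
by rewrite E pmulr_rgt0 // exprn_gt0.
Qed.

Lemma near_multiple (M t : int) : 0 < M -> exists a : int, 4 * (M * a + t) ^+ 2 <= M ^+ 2.
Proof.
(* The witness is minus the integer nearest to [t / M]. *)
move=> M0; exists (- ((2 * t + M) %/ (2 * M))%Z).
have := divz_eq (2 * t + M) (2 * M).
have := modz_ge0 (2 * t + M) (_ : 2 * M != 0).
have := ltz_pmod (2 * t + M) (_ : 0 < 2 * M).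
nia.
Qed.

(* Hermite's inequality.  A vector that is short for the Schur complement lifts,
   after rounding its first coordinate, to a vector of [G] which either is shorter
   than the first basis vector and replaces it, or already gives the bound. *)
Lemma hermite k (G : 'M[int]_k.+1) : posdef G -> exists2 U : 'M[int]_k.+1, U \in unitmx &
  3 ^+ 'C(k.+1, 2) * ((U *m G *m U^T) 0 0) ^+ k.+1 <= 4 ^+ 'C(k.+1, 2) * \det G.
Proof.
elim: k G => [|k IHk] G.
  exists 1%:M; first exact: unitmx1.
  by rewrite mul1mx trmx1 mulmx1 bin_small // !mul1r [X in \det X]mx11_scalar det_scalar1.
have [d] := ubnP (absz (G 0 0)); elim: d G => // d IHd G ltGd pG.
have [M0 pS] := @posdef_schur k.+1 G pG; have sG : G^T = G := pG.1.
have [V uV boundV] := IHk _ pS; set v := row 0 V.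
have M00 : ulsubmx (G : 'M_(1 + k.+1)) 0 0 = G 0 0.
  by rewrite !mxE; congr (G _ _); apply: val_inj.
have [a a_near] := near_multiple ((v *m dlsubmx (G : 'M_(1 + k.+1))) 0 0) M0.
have := @qform_block k.+1 G sG a v.
set r := row_mx _ _ => qr.
have vS : qform (schur (G : 'M_(1 + k.+1))) v = (V *m schur (G : 'M_(1 + k.+1)) *m V^T) 0 0.
  by rewrite -qform_delta qform_congr -rowE.
have [small|big] := leP (G 0 0) (qform G r).
  exists 1%:M; first exact: unitmx1.
  rewrite mul1mx trmx1 mulmx1.
  have dS := @det_schur k.+1 G; rewrite M00 in M0 a_near qr dS *.
  (* As [qform G r] is at least [G 0 0] and the rounded square is at most a quarter of [G 0 0 ^+ 2],
     the Schur form contributes at least the other three quarters. *)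
  have S_large : 3 * G 0 0 ^+ 2 <= 4 * qform (schur (G : 'M_(1 + k.+1))) v.
    have := small; rewrite -(ler_pM2l M0) qr -expr2; move: a_near.
    move: (_ ^+ 2) (qform _ _) (G 0 0 ^+ 2) => X m M2; lia.
  rewrite -vS in boundV; move: S_large boundV.
  set m := qform _ _; set e := 'C(k.+1, 2) => S_large boundV.
  have {}S_large : (3 * G 0 0 ^+ 2) ^+ k.+1 <= (4 * m) ^+ k.+1.
    have M2 : 0 <= 3 * G 0 0 ^+ 2 by rewrite mulr_ge0 ?sqr_ge0.
    by rewrite lerXn2r // nnegrE (le_trans M2).
  rewrite -(ler_pM2l (exprn_gt0 k.+1 M0)) binS bin1 -/e.
  rewrite [leRHS]mulrCA dS [3 ^+ _]exprD [4 ^+ _]exprD.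
  apply: le_trans (_ : 3 ^+ e * (G 0 0 * (4 * m) ^+ k.+1) <= _).
    have -> : G 0 0 ^+ k.+1 * (3 ^+ e * 3 ^+ k.+1 * G 0 0 ^+ k.+2)
       = 3 ^+ e * (G 0 0 * (3 * G 0 0 ^+ 2) ^+ k.+1).
      by rewrite exprMn -exprM mul2n -addnn exprD (exprSr _ k.+1); ring.
    by rewrite ler_pM2l ?exprn_gt0 // ler_pM2l.
  have -> : 3 ^+ e * (G 0 0 * (4 * m) ^+ k.+1) =
    4 ^+ k.+1 * G 0 0 * (3 ^+ e * m ^+ k.+1) by rewrite exprMn; ring.
  have -> : 4 ^+ e * 4 ^+ k.+1 * (G 0 0 * \det (schur (G : 'M_(1 + k.+1))))
    = 4 ^+ k.+1 * G 0 0 * (4 ^+ e * \det (schur (G : 'M_(1 + k.+1)))) by ring.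
  by rewrite ler_pM2l // mulr_gt0 ?exprn_gt0.
(* Before the swap the first row is (1, 0) and the others are the rows of [V] preceded by [a]. The
   swap puts [r] first, and the determinant is that of [V] up to sign. *)
pose W : 'M[int]_(k.+2) := xrow 0 (rshift 1 0) (block_mx 1%:M 0 (const_mx a) V : 'M_(1 + k.+1)).
have uW : W \in unitmx.
  rewrite /W xrowE unitmx_mul unitmx_perm /= unitmxE.
  by rewrite (det_lblock (1%:M : 'M_1)) det1 mul1r -unitmxE.
have rW : row 0 W = r.
  apply/rowP=> j; rewrite /W mxE mxE tpermL -[j](@splitK 1 k.+1).
  case: (@split 1 k.+1 j) => i /=.
    rewrite [LHS](@block_mxEdl _ 1 k.+1 1 k.+1).
    by rewrite [RHS](@row_mxEl _ 1 1 k.+1) !mxE ord1 eqxx.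
  rewrite [LHS](@block_mxEdr _ 1 k.+1 1 k.+1).
  by rewrite [RHS](@row_mxEr _ 1 1 k.+1) !mxE.
have W00 : (W *m G *m W^T) 0 0 = qform G r by rewrite -qform_delta qform_congr -rowE rW.
have [||U uU boundU] := IHd (W *m G *m W^T); last 1 first.
- exists (U *m W); first by rewrite unitmx_mul uU.
  by move: boundU; rewrite trmx_mul !mulmxA det_congr (unimodular_det uW).2 mul1r.
- have := (posdef_congr (unimodular_det uW).1 pG).2 (delta_mx 0 0).
  rewrite qform_delta W00 => q0.
  have : 0 < qform G r.
    apply: q0; apply/eqP=> /matrixP /(_ 0 0); by rewrite !mxE !eqxx.
  by move: ltGd big; move: (qform _ _) (G 0 0) => u w; lia.
- exact: posdef_congr (unimodular_det uW).1 pG.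
Qed.

Lemma qform_diag k (d v : 'rV[int]_k) : qform (diag_mx d) v = \sum_i d 0 i * v 0 i ^+ 2.
Proof.
rewrite /qform mul_mx_diag !mxE; apply: eq_bigr => i _; rewrite !mxE; ring.
Qed.

(** The rows of [B] span the lattice cut out by the divisibility, which has index [p]; the form
    diag(1, c, c, c) has determinant [c ^+ 3]. Hermite's inequality in dimension 4 has the constants
    3^6 = 729 and 4^6 = 4096. *)
Lemma short_vector (c : int) (p : nat) (a1 a2 a3 : int) : 0 < c -> (0 < p)%N ->
  exists x0 x1 x2 x3 : int,
  let A := x0 ^+ 2 + c * (x1 ^+ 2 + x2 ^+ 2 + x3 ^+ 2) in
  [/\ (p %| x0 + a1 * x1 + a2 * x2 + a3 * x3)%Z, 0 < A
    & 729 * A ^+ 4 <= 4096 * (c ^+ 3 * p%:Z ^+ 2)].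
Proof.
move=> c0 p0.
pose D : 'rV[int]_4 := \row_i (if i == ord0 then 1 else c).
pose B : 'M[int]_4 := \matrix_(i, j)
  (if j == ord0 then [:: p%:Z; - a1; - a2; - a3]`_i else (i == j)%:R).
pose i1 : 'I_4 := lift ord0 ord0.
pose i2 : 'I_4 := lift ord0 (lift ord0 ord0).
pose i3 : 'I_4 := lift ord0 (lift ord0 (lift ord0 ord0)).
have dB : \det B = p.
  rewrite det_trig ?big_ord_recl ?big_ord0 ?mxE //= ?mulr1 //.
  apply/is_trig_mxP => i j; rewrite mxE -(val_eqE i j); case: eqP => [->//|_] /=.
  by case: ltngtP.
have sumD x : qform (diag_mx D) x =
    x 0 ord0 ^+ 2 + c * (x 0 i1 ^+ 2 + x 0 i2 ^+ 2 + x 0 i3 ^+ 2).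
  rewrite qform_diag !big_ord_recl big_ord0 ![D _ _]mxE /=.
 ring.
have pD : posdef (diag_mx D).
  split; first by rewrite tr_diag_mx.
  move=> v; apply: contra_neqT; rewrite qform_diag -leNgt => le0.
  have D0 i : 0 < D 0 i by rewrite mxE; case: ifP.
  have D0' i : true -> 0 <= D 0 i * v 0 i ^+ 2 by rewrite mulr_ge0 ?sqr_ge0 // ltW.
  have : \sum_i D 0 i * v 0 i ^+ 2 == 0 by rewrite eq_le le0 sumr_ge0.
  rewrite psumr_eq0 // => /allP v0; apply/rowP => i; apply/eqP.
  have := v0 i (mem_index_enum i).
  by rewrite mulf_eq0 gt_eqF //= sqrf_eq0 [X in _ -> _ == X]mxE.
have dD : \det (diag_mx D) = c ^+ 3.
  by rewrite det_diag !big_ord_recl big_ord0 !mxE /=; ring.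
have pB : \det B != 0 by rewrite dB; lia.
have [|U uU] := @hermite 3 (B *m diag_mx D *m B^T); first exact: posdef_congr pD.
rewrite -qform_delta !qform_congr det_congr dB dD -!rowE.
set x := _ *m B => bnd.
exists (x 0 ord0), (x 0 i1), (x 0 i2), (x 0 i3) => A.
have AE : A = qform (diag_mx D) x by rewrite sumD.
split.
- apply/dvdzP; exists (U 0 0); rewrite !mxE !big_ord_recl !big_ord0 !mxE /=.
  rewrite -[0]/(ord0); ring.
- rewrite AE -qform_congr.
  have /posdef_congr := posdef_congr pB pD.
  move=> /(_ _ (unimodular_det uU).1) [_ /(_ (delta_mx 0 0))].
  rewrite !qform_congr -!rowE; apply.
  by apply/eqP=> /matrixP /(_ 0 0); rewrite !mxE !eqxx.
- by rewrite AE mulrC [c ^+ 3 * _]mulrC [_ * 729]mulrC.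
Qed.

(** * Arithmetic in Z[z] modulo a prime ideal *)

Lemma pevD q r x : pev (q + r) x = pev q x + pev r x.
Proof. by rewrite /pev rmorphD hornerD. Qed.

Lemma pevN q x : pev (- q) x = - pev q x.
Proof. by rewrite /pev rmorphN hornerN. Qed.

Lemma pevM q r x : pev (q * r) x = pev q x * pev r x.
Proof. by rewrite /pev rmorphM hornerM. Qed.

Lemma pevXn q k x : pev (q ^+ k) x = pev q x ^+ k.
Proof. by rewrite /pev rmorphXn horner_exp. Qed.

Lemma pevC (c : int) x : pev c%:P x = c%:~R.
Proof. by rewrite /pev map_polyC hornerC. Qed.

Lemma pevX x : pev 'X x = x.
Proof. by rewrite /pev map_polyX hornerX. Qed.

Lemma pev_comp q r x : pev (q \Po r) x = pev q (pev r x).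
Proof. by rewrite /pev map_comp_poly horner_comp. Qed.

Lemma pev_rmorph (u : {rmorphism algC -> algC}) q x : u (pev q x) = pev q (u x).
Proof.
rewrite /pev -horner_map -map_poly_comp; congr (_.[_]).
by apply: eq_map_poly => c /=; rewrite rmorph_int.
Qed.

Section Zz.
Variable z : algC.

Lemma inZzD x y : inZz z x -> inZz z y -> inZz z (x + y).
Proof. by move=> [q ->] [r ->]; exists (q + r); rewrite pevD. Qed.

Lemma inZzN x : inZz z x -> inZz z (- x).
Proof. by move=> [q ->]; exists (- q); rewrite pevN. Qed.

Lemma inZzB x y : inZz z x -> inZz z y -> inZz z (x - y).
Proof. by move=> Zx Zy; apply: inZzD => //; apply: inZzN. Qed.

Lemma inZzM x y : inZz z x -> inZz z y -> inZz z (x * y).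
Proof. by move=> [q ->] [r ->]; exists (q * r); rewrite pevM. Qed.

Lemma inZz_int (a : int) : inZz z a%:~R.
Proof. by exists a%:P; rewrite pevC. Qed.

Lemma inZz1 : inZz z 1. Proof. exact: (inZz_int 1). Qed.

Lemma inZzX x k : inZz z x -> inZz z (x ^+ k).
Proof. by move=> [q ->]; exists (q ^+ k); rewrite pevXn. Qed.

Lemma inZz_gen : inZz z z. Proof. by exists 'X; rewrite pevX. Qed.

Lemma inZz_pev q x : inZz z x -> inZz z (pev q x).
Proof. by move=> [r ->]; exists (q \Po r); rewrite pev_comp. Qed.

End Zz.

Section ModP.
Variable p : nat.
Hypothesis p_pr : prime p.
Local Notation modp := (map_poly (intr : int -> 'F_p)).

Lemma modp_eq0 (Q : {poly int}) : modp Q = 0 -> exists R : {poly int}, Q = p%:Z *: R.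
Proof.
move=> Q0; exists (\poly_(i < size Q) (Q`_i %/ p)%Z).
apply/polyP=> i; rewrite coefZ coef_poly; case: ltnP => [_|/leq_sizeP-> //]; last first.
  by rewrite mulr0.
rewrite mulrC divzK //.
have /polyP /(_ i) := Q0; rewrite coef_map coef0 /= => /eqP.
by rewrite (dvdz_pcharf (pchar_Fp p_pr)).
Qed.

(** The [p]-th power map is additive and fixes the coefficients. *)
Lemma poly_Fp_frobenius (q : {poly 'F_p}) : q ^+ p = q \Po 'X^p.
Proof.
elim/poly_ind: q => [|q c IHq]; first by rewrite comp_poly0 expr0n; case: p p_pr.
have chp : [pchar {poly 'F_p}].-nat p.
  by rewrite pnatE // pchar_poly pchar_Fp.
rewrite comp_polyD comp_polyM comp_polyX comp_polyC exprDn_pchar // exprMn IHq.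
by have := expf_card c; rewrite (card_Fp p_pr) -rmorphXn /= => ->.
Qed.

Lemma prod_XsubC_Fp :
  modp (\prod_(a : 'F_p) ('X - (a : nat)%:Z%:P) - ('X^p - 'X)) = 0.
Proof.
rewrite rmorphB rmorph_prod rmorphB rmorphXn /= map_polyX.
have := finField_genPoly 'F_p; rewrite (card_Fp p_pr) => ->.
apply/eqP; rewrite subr_eq0; apply/eqP/eq_bigr => a _.
by rewrite rmorphB /= map_polyX map_polyC /= -pmulrn natr_Zp.
Qed.

Variables (z : algC) (P : algC -> Prop).
Hypotheses (Pprime : is_prime_ideal z P) (Pover : lies_over P p).

Lemma ideal_inZz x : P x -> inZz z x.
Proof. by case: Pprime => [[? ? ? ?] ? ?]; auto. Qed.

Lemma idealD x y : P x -> P y -> P (x + y).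
Proof. by case: Pprime => [[? ? ? ?] ? ?]; auto. Qed.

Lemma idealMl r x : inZz z r -> P x -> P (r * x).
Proof. by case: Pprime => [[? ? ? ?] ? ?]; auto. Qed.

Lemma idealN x : P x -> P (- x).
Proof. by rewrite -mulN1r; apply: idealMl; apply: (inZz_int z (-1)). Qed.

Lemma idealB x y : P x -> P y -> P (x - y).
Proof. by move=> Px /idealN; apply: idealD. Qed.

Lemma ideal_sum (I : Type) (r : seq I) (Q : pred I) (F : I -> algC) :
  (forall i, Q i -> P (F i)) -> P (\sum_(i <- r | Q i) F i).
Proof.
by move=> PF; apply: big_ind => //; [case: Pprime => [[? ? ? ?] ? ?] | apply: idealD].
Qed.

Lemma prime_idealM x y : inZz z x -> inZz z y -> P (x * y) -> P x \/ P y.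
Proof. by case: Pprime => [[? ? ? ?] ? ?]; auto. Qed.

Lemma ideal_int (a : int) : P a%:~R <-> (p %| a)%Z.
Proof. exact: Pover. Qed.

Lemma prime_ideal_prod (I : Type) (r : seq I) (F : I -> algC) :
  (forall i, inZz z (F i)) -> P (\prod_(i <- r) F i) -> exists i, P (F i).
Proof.
move=> ZF; elim: r => [|i r IHr]; first by rewrite big_nil => P1; case: Pprime.
rewrite big_cons => /prime_idealM[] //; last by exists i.
apply: (big_ind (inZz z)) => //; [exact: inZz1 | exact: inZzM].
Qed.

Lemma ideal_modp Q x : modp Q = 0 -> inZz z x -> P (pev Q x).
Proof.
move=> /modp_eq0[R ->] Zx; rewrite -mul_polyC mulrC pevM pevC.
by apply: idealMl; [exact: inZz_pev | apply/ideal_int].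
Qed.

Lemma ideal_frobenius_sub q x : inZz z x -> P (pev q x ^+ p - pev q (x ^+ p)).
Proof.
move=> Zx; have Q0 : modp (q ^+ p - (q \Po 'X^p)) = 0.
  by rewrite rmorphB rmorphXn /= map_comp_poly map_polyXn poly_Fp_frobenius subrr.
by have := ideal_modp Q0 Zx; rewrite pevD pevN pevXn pev_comp pevXn pevX.
Qed.

Lemma ideal_frobenius q k : P (pev q (z ^+ k)) -> P (pev q (z ^+ (k * p))).
Proof.
move=> Pq; rewrite exprM.
have Zzk : inZz z (z ^+ k) by apply/inZzX/inZz_gen.
rewrite -[pev q _](subKr (pev q (z ^+ k) ^+ p)).
apply: idealB (ideal_frobenius_sub q Zzk); case: p p_pr => // e _.
by rewrite exprSr; apply: idealMl => //; apply/inZzX/inZz_pev.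
Qed.

Lemma ideal_congM f g (a b : int) : inZz z f -> P (f - a%:~R) -> P (g - b%:~R) ->
  P (f * g - (a * b)%:~R).
Proof.
move=> Zf Pf Pg; have -> : f * g - (a * b)%:~R = f * (g - b%:~R) + b%:~R * (f - a%:~R).
  by rewrite rmorphM /=; ring.
by apply: idealD; apply: idealMl => //; apply: inZz_int.
Qed.

(** Modulo [P] each [fi] is the integer [ai], so the lattice of [short_vector] maps into [P]. *)
Lemma ideal_lattice f1 f2 f3 (a1 a2 a3 x0 x1 x2 x3 : int) :
  P (f1 - a1%:~R) -> P (f2 - a2%:~R) -> P (f3 - a3%:~R) ->
  (p %| x0 + a1 * x1 + a2 * x2 + a3 * x3)%Z ->
  P (x0%:~R + x1%:~R * f1 + x2%:~R * f2 + x3%:~R * f3).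
Proof.
move=> P1 P2 P3 /ideal_int Px.
have PZ c f : P f -> P (c%:~R * f) by apply: idealMl; apply: inZz_int.
have := idealD (idealD (idealD Px (PZ x1 _ P1)) (PZ x2 _ P2)) (PZ x3 _ P3).
by rewrite !rmorphD !rmorphM /=; congr P; ring.
Qed.

(** Modulo [p] the product of all ['X - a] is ['X^p - 'X], so its value at [y] lies in [P], and
    primality selects a factor. *)
Lemma ideal_residue y : inZz z y -> P (y ^+ p - y) -> exists a : int, P (y - a%:~R).
Proof.
move=> Zy Py.
have := ideal_modp prod_XsubC_Fp Zy.
rewrite pevD pevN pevD pevN pevXn pevX => /idealD /(_ Py); rewrite subrK.
rewrite (big_morph (fun q => pev q y) (fun q r => pevM q r y) (pevC 1 y)).
move/prime_ideal_prod => [a|a]; first by apply: inZz_pev.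
by rewrite pevD pevN pevX pevC; exists a%:Z.
Qed.

End ModP.

(** * The form A^2 - 2 B^2 over the integers *)

Lemma Euclid_dvdz (p : nat) (x y : int) : prime p -> (p %| x * y)%Z -> (p %| x)%Z \/ (p %| y)%Z.
Proof. by move=> p_pr; rewrite !dvdzE abszM Euclid_dvdM // => /orP. Qed.

Lemma sqrt2_irrational (x y : int) : x ^+ 2 = 2 * y ^+ 2 -> x = 0.
Proof.
have [n] := ubnP (absz x); elim: n x y => // n IHn x y ltxn xy.
have [//|x0] := eqVneq x 0.
have : (2%N %| x)%Z.
  have : (2%N %| x * x)%Z by apply/dvdzP; exists (y ^+ 2); lia.
  by case/Euclid_dvdz.
case/dvdzP=> u xE; rewrite {}xE in xy ltxn x0 *.
have : (2%N %| y)%Z.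
  have : (2%N %| y * y)%Z by apply/dvdzP; exists (u ^+ 2); lia.
  by case/Euclid_dvdz.
case/dvdzP=> v yE; rewrite {}yE in xy.
have : u = 0 by apply: (IHn _ v); lia.
by move=> ->.
Qed.

(** For an odd prime [q] this says that 2 is not a square modulo [q], that is, [q] is inert in
    Z[sqrt 2]. *)
Definition anisotropic (q : nat) : Prop :=
  forall a b : int, (q %| a ^+ 2 - 2 * b ^+ 2)%Z -> (q %| a)%Z /\ (q %| b)%Z.

Lemma anisotropic_3 : anisotropic 3.
Proof.
move=> a b.
have rem (x : int) : exists y r : int, x = 3 * y + r /\ (-1 <= r <= 1).
  by exists ((x + 1) %/ 3)%Z, (((x + 1) %% 3)%Z - 1); split; lia.
have [c [r [-> rE]]] := rem a; have [d [s [-> sE]]] := rem b.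
move=> /dvdzP[t E].
have {}E : r ^+ 2 - 2 * s ^+ 2 = 3 * (t - 3 * c ^+ 2 - 2 * c * r + 6 * d ^+ 2 + 4 * d * s).
  by lia.
have [r0 s0] : r = 0 /\ s = 0.
  have : [|| r == -1, r == 0 | r == 1] by lia.
  have : [|| s == -1, s == 0 | s == 1] by lia.
  by case/or3P=> /eqP sE' /or3P[]/eqP rE'; move: E; rewrite sE' rE'; lia.
by split; apply/dvdzP; [exists c | exists d]; lia.
Qed.

Lemma anisotropic_5 : anisotropic 5.
Proof.
move=> a b.
have rem (x : int) : exists y r : int, x = 5 * y + r /\ (-2 <= r <= 2).
  by exists ((x + 2) %/ 5)%Z, (((x + 2) %% 5)%Z - 2); split; lia.
have [c [r [-> rE]]] := rem a; have [d [s [-> sE]]] := rem b.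
move=> /dvdzP[t E].
have {}E : r ^+ 2 - 2 * s ^+ 2 = 5 * (t - 5 * c ^+ 2 - 2 * c * r + 10 * d ^+ 2 + 4 * d * s).
  by lia.
have [r0 s0] : r = 0 /\ s = 0.
  have : [|| r == -2, r == -1, r == 0, r == 1 | r == 2] by lia.
  have : [|| s == -2, s == -1, s == 0, s == 1 | s == 2] by lia.
  by case/or4P=> [||| /orP[]] /eqP sE' /or4P[||| /orP[]]/eqP rE'; move: E; rewrite sE' rE'; lia.
by split; apply/dvdzP; [exists c | exists d]; lia.
Qed.

(** Both coordinates would be divisible by [q], so the norm by [q ^ 2], and [q] would divide [p]. *)
Lemma anisotropic_norm (q p : nat) (x y : int) :
  prime q -> prime p -> p != q -> anisotropic q -> x ^+ 2 - 2 * y ^+ 2 <> q%:Z * p%:Z.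
Proof.
move=> q_pr p_pr pq qf xy.
have [/dvdzP[u xE] /dvdzP[v yE]] : (q %| x)%Z /\ (q %| y)%Z.
  by apply: qf; rewrite xy dvdz_mulr.
have q0 : q%:Z != 0 by have := prime_gt0 q_pr; lia.
have : (q %| p%:Z)%Z.
  apply/dvdzP; exists (u ^+ 2 - 2 * v ^+ 2); apply: (mulfI q0).
  by rewrite -xy xE yE; ring.
by rewrite dvdzE /= dvdn_prime2 // eq_sym (negPf pq).
Qed.

(** An odd multiplier other than 1 would be one of the inert primes 3 and 5. An even one makes [x]
    even, which is what the division by the prime above 2 requires. *)
Lemma norm_multiplier (p : nat) (k x y : int) :
  prime p -> (7 <= p)%N -> 0 < k < 7 -> x ^+ 2 - 2 * y ^+ 2 = k * p%:Z ->
  k = 1 \/ exists2 l, k = 2 * l & (2%N %| x)%Z.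
Proof.
move=> p_pr p7 k7 xy.
have [|]: (2%N %| k)%Z \/ ~ (2%N %| k)%Z by case: (2%N %| k)%Z; [left|right].
  move=> /dvdzP[l kE]; right; exists l; first by rewrite kE mulrC.
  have : (2%N %| x * x)%Z by apply/dvdzP; exists (l * p%:Z + y ^+ 2); lia.
  by case/Euclid_dvdz.
move=> k2; left.
have k35 : k = 1 \/ k = 3 \/ k = 5 by lia.
case: k35 => [//|[] kE]; rewrite kE in xy.
  by case: (@anisotropic_norm 3 p x y _ _ _ anisotropic_3) => //; lia.
by case: (@anisotropic_norm 5 p x y _ _ _ anisotropic_5) => //; lia.
Qed.

(** With [s ^ 2 = 2], the middle term is the rational part of [A + |B| s] times the unit [3 - 2 s].
    It is positive because [9 A^2 - 16 B^2 = A^2 + 8 p], and below [A] because [A^2 < 4 B^2] amounts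
    to [2 p < A^2]. *)
Lemma pell_reduce (p A B : int) : 0 < p -> 0 < A -> A ^+ 2 - 2 * B ^+ 2 = p -> 2 * p < A ^+ 2 ->
  0 < 3 * A - 4 * `|B| < A.
Proof.
move=> p0 A0; rewrite -[B ^+ 2](@real_normK _ B) ?num_real // => AB Ap.
have := normr_ge0 B; move: `|B| AB => {}B AB B0.
by apply/andP; split; nia.
Qed.

(** Up to the sign of [B], the quotient of [A + B s] by [a + b s] is a unit [c - d s] of norm 1,
    where [s ^ 2 = 2]; the size bounds leave only [d = 0]. *)
Lemma pell_reduced_unique (p : nat) (A B a b : int) : prime p -> odd p -> 0 < A -> 0 < a ->
  A ^+ 2 - 2 * B ^+ 2 = p%:Z -> a ^+ 2 - 2 * b ^+ 2 = p%:Z ->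
  A ^+ 2 <= 2 * p%:Z -> a ^+ 2 <= 2 * p%:Z -> A = a.
Proof.
move=> p_pr p_odd A0 a0 AB ab.
(* [p] divides the product of [A * b - a * B] and [A * b + a * B], and changing the sign of [B]
   exchanges the two factors. *)
wlog pAb : B AB / (p %| A * b - a * B)%Z.
  move=> hw; have : (p %| (A * b - a * B) * (A * b + a * B))%Z.
    apply/dvdzP; exists (b ^+ 2 - B ^+ 2).
    have -> : (A * b - a * B) * (A * b + a * B) = A ^+ 2 * b ^+ 2 - a ^+ 2 * B ^+ 2 by ring.
    have -> : A ^+ 2 = p%:Z + 2 * B ^+ 2 by rewrite -AB; ring.
    have -> : a ^+ 2 = p%:Z + 2 * b ^+ 2 by rewrite -ab; ring.
    by ring.
  case/(Euclid_dvdz p_pr); first exact: hw.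
  by move=> h; apply: (hw (- B)); [rewrite sqrrN | rewrite mulrN opprK].
move=> A2 a2.
have neq2p (x : int) : x ^+ 2 <> 2 * p%:Z.
  move=> x2; have : (2%N %| x * x)%Z by apply/dvdzP; exists p%:Z; lia.
  move=> /Euclid_dvdz [] // /dvdzP[u xE]; rewrite xE in x2; lia.
have {}A2 : A ^+ 2 < 2 * p%:Z by rewrite lt_neqAle A2 andbT; apply/eqP.
have {neq2p}a2 : a ^+ 2 < 2 * p%:Z by rewrite lt_neqAle a2 andbT; apply/eqP.
have p0 : 0 < p%:Z by have := prime_gt0 p_pr; lia.
have normM : (A * a - 2 * (B * b)) ^+ 2 = 2 * (A * b - a * B) ^+ 2 + p%:Z * p%:Z.
  have -> : p%:Z * p%:Z = (A ^+ 2 - 2 * B ^+ 2) * (a ^+ 2 - 2 * b ^+ 2) by rewrite AB ab.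
  by ring.
have pAa : (p %| A * a - 2 * (B * b))%Z.
  have : (p %| (A * a - 2 * (B * b)) * (A * a - 2 * (B * b)))%Z.
    case/dvdzP: pAb => d dE; apply/dvdzP; exists (2 * d ^+ 2 * p%:Z + p%:Z).
    by rewrite -expr2 normM dE; ring.
  by case/(Euclid_dvdz p_pr).
have pp : p%:Z ^+ 2 != 0 by rewrite expf_neq0 // gt_eqF.
case/dvdzP: pAb => d dE; case/dvdzP: pAa => c cE.
have cd : c ^+ 2 - 2 * d ^+ 2 = 1.
  apply: (mulIf pp).
  have -> : (c ^+ 2 - 2 * d ^+ 2) * p%:Z ^+ 2 = (c * p%:Z) ^+ 2 - 2 * (d * p%:Z) ^+ 2 by ring.
  by rewrite -cE -dE mul1r normM; ring.
(* [(A b - a B)^2 <= 2 (A^2 b^2 + a^2 B^2)], which is below [4 p^2] since [2 b^2] and [2 B^2] are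
   below [p] and [A^2] and [a^2] below [2 p]. *)
have d4 : d ^+ 2 < 4.
  rewrite -(ltr_pM2r (_ : 0 < p%:Z ^+ 2)) ?exprn_gt0 // -exprMn -dE.
  apply: (@le_lt_trans _ _ (2 * (A ^+ 2 * b ^+ 2 + a ^+ 2 * B ^+ 2))).
    by have := sqr_ge0 (A * b + a * B); lia.
  have [b2 B2] : 2 * b ^+ 2 < p%:Z /\ 2 * B ^+ 2 < p%:Z.
    by split; [clear -ab a2; lia | clear -AB A2; lia].
  have h1 : A ^+ 2 * (2 * b ^+ 2) <= A ^+ 2 * p%:Z by rewrite ler_wpM2l ?sqr_ge0 // ltW.
  have h2 : a ^+ 2 * (2 * B ^+ 2) <= a ^+ 2 * p%:Z by rewrite ler_wpM2l ?sqr_ge0 // ltW.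
  have h3 : A ^+ 2 * p%:Z < 2 * p%:Z * p%:Z by rewrite ltr_pM2r.
  have h4 : a ^+ 2 * p%:Z < 2 * p%:Z * p%:Z by rewrite ltr_pM2r.
  by clear -h1 h2 h3 h4; lia.
have d0 : d = 0.
  have d2 : -2 < d < 2 by clear -d4; apply/andP; split; nia.
  have c3 : c ^+ 2 <> 3.
    have : c <= - 2 \/ 2 <= c \/ c = -1 \/ c = 0 \/ c = 1 by clear; lia.
    by case=> [|[|[->|[->|->]]]] //; clear; nia.
  have [d1|[//|d1]] : d = -1 \/ d = 0 \/ d = 1 by clear -d2; lia.
    by case: c3; move: cd; rewrite d1; clear; lia.
  by case: c3; move: cd; rewrite d1; clear; lia.
have Bb : B ^+ 2 = b ^+ 2.
  apply: (mulfI (_ : p%:Z != 0)); first by rewrite gt_eqF.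
  have Ab : A * b = a * B by move: dE; rewrite d0; clear; lia.
  have : A ^+ 2 * b ^+ 2 = a ^+ 2 * B ^+ 2 by rewrite -!exprMn Ab.
  have -> : A ^+ 2 = p%:Z + 2 * B ^+ 2 by rewrite -AB; ring.
  have -> : a ^+ 2 = p%:Z + 2 * b ^+ 2 by rewrite -ab; ring.
  by clear; lia.
have /eqP : A ^+ 2 = a ^+ 2 by clear -AB ab Bb; lia.
by rewrite eqrXn2 ?ltW // => /eqP.
Qed.

(* Modulo any power of 2, [9 + 16 * u] generates the units congruent to 1 mod 8. *)
Lemma pow_1mod8 (u j : int) (e : nat) :
  exists (i : nat) (t : int), (9 + 16 * u) ^+ i - (8 * j + 1) = 2 ^+ e * t.
Proof.
set g := 9 + 16 * u.
have g1 k : exists t : int, g ^+ k = 8 * t + 1.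
  elim: k => [|k [t IHk]]; first by exists 0.
  by exists (t * g + 1 + 2 * u); rewrite exprSr IHk /g; ring.
have g2 k : exists v : int, g ^+ (2 ^ k) = 1 + 2 ^+ k * (8 * (2 * v + 1)).
  elim: k => [|k [v IHk]]; first by exists u; rewrite /g; ring.
  exists (v + 2 * 2 ^+ k * (2 * v + 1) ^+ 2).
  by rewrite expnSr exprM IHk [2 ^+ k.+1]exprSr; ring.
suff [i [t E]] : exists (i : nat) (t : int), g ^+ i - (8 * j + 1) = 2 ^+ e * (8 * t).
  by exists i, (8 * t).
elim: e => [|e [i [t IHe]]].
  by exists 0%N, (- j); ring.
(* If the quotient [t] is odd, the factor [g ^+ (2 ^ e)], which is 1 plus an odd multiple of
   [8 * 2 ^+ e], corrects the next binary digit. *)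
have [s [tE|tE]] : exists s : int, t = 2 * s \/ t = 2 * s + 1.
  by exists (t %/ 2)%Z; lia.
  by exists i, s; rewrite IHe tE [2 ^+ e.+1]exprSr; ring.
have [v vE] := g2 e; have [w wE] := g1 i.
exists (i + 2 ^ e)%N, (s + 1 + v * g ^+ i + 4 * w).
have -> : g ^+ (i + 2 ^ e) - (8 * j + 1) =
  (g ^+ i - (8 * j + 1)) + g ^+ i * (g ^+ (2 ^ e) - 1) by rewrite exprD; ring.
by rewrite IHe vE tE wE [2 ^+ e.+1]exprSr; ring.
Qed.

(** * Bounds from the minimal solution of a^2 - 2 b^2 = p *)

Section MinimalSolution.
Variables p a b : nat.
Hypotheses (p_pr : prime p) (a0 : (0 < a)%N).
Hypothesis ab : (a ^ 2 = 2 * b ^ 2 + p)%N.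
Hypothesis a_min : forall c d : nat, (0 < c)%N -> (0 < d)%N -> (c ^ 2 = 2 * d ^ 2 + p)%N ->
  (a <= c)%N.

(** The sign of [B] does not matter, and [B = 0] would make the prime [p] a square. *)
Lemma minimal_norm_p (A B : int) : 0 < A -> A ^+ 2 - 2 * B ^+ 2 = p%:Z -> a%:Z <= A.
Proof.
move=> A0 AB; have B0 : B != 0.
  apply/eqP=> B0; rewrite B0 in AB; have Ap : A * A = p%:Z by move: AB; clear; lia.
  have pA : (p %| A)%Z by have : (p %| A * A)%Z; [rewrite Ap | case/(Euclid_dvdz p_pr)].
  case/dvdzP: pA => c cE; have p0 : p%:Z != 0 by rewrite eqz_nat -lt0n prime_gt0.
  have /dvdzP/[!dvdzE] : exists d, 1 = d * p%:Z.
    by exists (c ^+ 2); apply: (mulIf p0); rewrite mul1r -[LHS]Ap cE; ring.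
  by rewrite dvdn1 => /eqP p1; have := prime_gt1 p_pr; rewrite -[p]/(absz p) p1.
have := @a_min (absz A) (absz B); rewrite !absz_gt0 B0 gt_eqF //= => /(_ isT isT).
have AA : (absz A ^ 2)%N = A ^+ 2 :> int by rewrite -abszX gez0_abs // sqr_ge0.
have BB : (absz B ^ 2)%N = B ^+ 2 :> int by rewrite -abszX gez0_abs // sqr_ge0.
by move: AA BB A0 AB; clear; lia.
Qed.

(** Otherwise multiplication by [3 - 2 s], where [s ^ 2 = 2], would give a smaller solution, by
    [pell_reduce]. *)
Lemma minimal_le : (a ^ 2 <= 2 * p)%N.
Proof.
rewrite leqNgt; apply/negP=> big; have p0 := prime_gt0 p_pr.
have abZ : a%:Z ^+ 2 - 2 * b%:Z ^+ 2 = p%:Z by move: ab; clear; lia.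
have /andP[red0 redlt] : 0 < 3 * a%:Z - 4 * `|b%:Z| < a%:Z.
  by apply: pell_reduce abZ _; move: p0 a0 big; clear; lia.
have := minimal_norm_p (B := 3 * b%:Z - 2 * a%:Z) red0.
rewrite ger0_norm // in redlt *.
have -> : (3 * a%:Z - 4 * b%:Z) ^+ 2 - 2 * (3 * b%:Z - 2 * a%:Z) ^+ 2
  = a%:Z ^+ 2 - 2 * b%:Z ^+ 2 by ring.
by move=> /(_ abZ); rewrite leNgt redlt.
Qed.

Lemma minimal_norm_multiple (A B : int) :
  0 < A -> 0 < A ^+ 2 - 2 * B ^+ 2 -> (p %| A ^+ 2 - 2 * B ^+ 2)%Z -> a%:Z <= A.
Proof.
move=> A0 N0 /dvdzP[k kE]; have p0 := prime_gt0 p_pr.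
have k0 : 0 < k by rewrite -(pmulr_lgt0 k (_ : 0 < p%:Z)) -?kE // ltz_nat.
have [k1|k2] := leP k 1.
  by apply: (minimal_norm_p (B := B)) => //; rewrite kE (_ : k = 1) ?mul1r //; clear -k0 k1; lia.
have pk : 2 * p%:Z <= k * p%:Z by rewrite ler_pM2r ?ltz_nat // ; clear -k2; lia.
have : a%:Z ^+ 2 <= A ^+ 2.
  by have := minimal_le; move: (sqr_ge0 B) pk kE; clear; lia.
by rewrite ler_pXn2r ?nnegrE // ltW.
Qed.

End MinimalSolution.

(** In the worst case [c = 2] the constant is 32768 / 729 < 49. The factor 7 will keep the
    multiplier [k] in [A^2 - 2 B^2 = k p] below 7. *)
Lemma short_bound (c A : int) (p : nat) : (0 < p)%N -> 0 < c <= 2 ->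
  729 * A ^+ 4 <= 4096 * (c ^+ 3 * p%:Z ^+ 2) -> A ^+ 2 < 7 * p%:Z.
Proof.
move=> p0 c2 le4; have {c2} c8 : c ^+ 3 <= 8.
  have [->|->] : c = 1 \/ c = 2 by clear -c2; lia.
    by [].
  by [].
have {c8}le8 : c ^+ 3 * p%:Z ^+ 2 <= 8 * p%:Z ^+ 2 by rewrite ler_wpM2r ?sqr_ge0.
have pp : 0 < p%:Z ^+ 2 by rewrite exprn_gt0 // ltz_nat.
rewrite ltNge; apply/negP=> big.
have : (7 * p%:Z) ^+ 2 <= (A ^+ 2) ^+ 2 by rewrite lerXn2r ?nnegrE ?sqr_ge0.
rewrite exprMn -exprM; move: le4 le8 pp; clear; move: (A ^+ _) (p%:Z ^+ 2) (c ^+ 3 * _).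
by lia.
Qed.

(** * Sums over conjugates *)

Lemma conj_unity_root (x : algC) k : (0 < k)%N -> x ^+ k = 1 -> x^* = x^-1.
Proof.
move=> k0 xk; have x1 : `|x| = 1.
  by apply/eqP; rewrite -(pexpr_eq1 k0) // -normrX xk normr1.
by rewrite invC_norm x1 expr1n invr1 mul1r.
Qed.

Lemma conj_pev q (x : algC) : (pev q x)^* = pev q x^*.
Proof. exact: (pev_rmorph (@Num.conj algC)). Qed.

Lemma algC_sqrt2_irrational (s : algC) (a b : int) :
  s ^+ 2 = 2 -> a%:~R = b%:~R * s -> a = 0 /\ b = 0.
Proof.
move=> s2 ab; have ab2 : a ^+ 2 = 2 * b ^+ 2.
  by apply: (@intr_inj algC); rewrite [RHS]rmorphM !rmorphXn /= ab exprMn s2 mulrC.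
have a0 := sqrt2_irrational ab2; split=> //; move: ab2; rewrite a0.
by move=> b2; apply/eqP; rewrite -sqrf_eq0; apply/eqP; clear -b2; lia.
Qed.

Lemma sum_octaves (V : nmodType) M (F : nat -> V) :
  \sum_(k < 8 * M | odd k) F k =
  \sum_(j < M) (F (8 * j + 1)%N + F (8 * j + 3)%N + F (8 * j + 5)%N + F (8 * j + 7)%N).
Proof.
elim: M => [|M IHM]; first by rewrite !big_ord0.
rewrite big_ord_recr -IHM /= mulnS addnC.
rewrite big_split_ord /=; congr (_ + _).
rewrite (eq_bigl (fun i : 'I_8 => odd i)) => [|i]; last by rewrite /= oddD oddM.
rewrite big_mkcond /= !big_ord_recl big_ord0 /= ?(add0r, addr0).
by rewrite !addrA.
Qed.

Section Cyclotomic.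
Variables (M : nat) (z : algC).
Hypothesis M0 : (0 < M)%N.
Hypothesis z_prim : (8 * M).-primitive_root z.
Local Notation m := (8 * M)%N.
(* A primitive 8th root of unity, and a square root of 2. *)
Local Notation w := (z ^+ M).
Local Notation s := (w - w ^+ 3).

Lemma zeta8_pow4 : w ^+ 4 = -1.
Proof.
have /eqP : (w ^+ 4) ^+ 2 = 1.
  by rewrite -!exprM -(prim_expr_order z_prim); congr (_ ^+ _); clear; lia.
rewrite sqrf_eq1 => /orP[|/eqP//].
rewrite -exprM -(prim_order_dvd z_prim) => /dvdn_leq.
by clear -M0; lia.
Qed.

Lemma sqrt2_sqr : s ^+ 2 = 2.
Proof.
have -> : s ^+ 2 = w ^+ 2 - 2 * w ^+ 4 + w ^+ 4 * w ^+ 2 by ring.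
by rewrite zeta8_pow4; ring.
Qed.

Lemma conj_zeta8 : w^* = - w ^+ 3.
Proof.
have w8 : w ^+ 8 = 1 by rewrite -[8%N]/(4 * 2)%N exprM zeta8_pow4 sqrrN expr1n.
rewrite (conj_unity_root (isT : 0 < 8)%N w8); apply: (mulfI (_ : w != 0)).
  by apply/eqP=> w0; move: w8; rewrite w0 expr0n /= => /eqP; rewrite eq_sym oner_eq0.
rewrite mulfV; first by rewrite mulrN -exprS zeta8_pow4 opprK.
by apply/eqP=> w0; move: w8; rewrite w0 expr0n /= => /eqP; rewrite eq_sym oner_eq0.
Qed.

Lemma zeta8_pow_odd k : odd k -> w ^+ (4 * k) = -1.
Proof. by move=> ok; rewrite exprM zeta8_pow4 -signr_odd ok. Qed.

Lemma sqrt2_conjugates : [/\ w ^+ 3 - w ^+ (3 * 3) = - s, w ^+ 5 - w ^+ (3 * 5) = - s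
  & w ^+ 7 - w ^+ (3 * 7) = s].
Proof.
move: (z ^+ M) zeta8_pow4 => x x4.
have -> : x ^+ (3 * 3) = x ^+ 4 ^+ 2 * x by rewrite -[(3 * 3)%N]/9%N; ring.
have -> : x ^+ 5 = x ^+ 4 * x by ring.
have -> : x ^+ (3 * 5) = x ^+ 4 ^+ 3 * x ^+ 3 by rewrite -[(3 * 5)%N]/15%N; ring.
have -> : x ^+ 7 = x ^+ 4 * x ^+ 3 by ring.
have -> : x ^+ (3 * 7) = x ^+ 4 ^+ 5 * x by rewrite -[(3 * 7)%N]/21%N; ring.
by rewrite x4; split; ring.
Qed.

Lemma conj_z : z^* = z ^+ m.-1.
Proof.
have zm := prim_expr_order z_prim; have m0 : (0 < m)%N by rewrite muln_gt0.
have z0 : z != 0.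
  by apply: contra_eqN zm => /eqP->; rewrite expr0n -leqn0 leqNgt m0 /= eq_sym oner_eq0.
by rewrite (conj_unity_root m0 zm); apply: (mulfI z0); rewrite mulfV // -exprS prednK.
Qed.

Lemma inZz_conj x : inZz z x -> inZz z x^*.
Proof.
by move=> [q ->]; rewrite conj_pev conj_z; apply: inZz_pev; apply/inZzX/inZz_gen.
Qed.

(** As [z^* = z ^+ m.-1], this turns the squared absolute value at every power of [z] into the value
    of one polynomial. *)
Definition sqnorm_poly (q : {poly int}) : {poly int} := q * (q \Po 'X^(m.-1)).

Lemma pev_sqnorm q k : pev (sqnorm_poly q) (z ^+ k) = `|pev q (z ^+ k)| ^+ 2.
Proof.
by rewrite pevM pev_comp pevXn pevX normCK conj_pev rmorphXn /= conj_z exprAC.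
Qed.

(** Up to the factor [z ^+ (r * i)] this is a geometric sum, which vanishes unless [M] divides [i];
    then [z ^+ i] is a power of [w]. The coefficients must not depend on [r], since the residue
    classes are compared later. *)
Lemma octave_sum_Xn i : exists c0 c1 c2 c3 : int, forall r, odd r ->
  \sum_(j < M) z ^+ (8 * j + r) ^+ i =
  M%:R * (c0%:~R + c1%:~R * w ^+ r + c2%:~R * w ^+ (2 * r) + c3%:~R * w ^+ (3 * r)).
Proof.
have sumE r : \sum_(j < M) z ^+ (8 * j + r) ^+ i =
    z ^+ (r * i) * \sum_(j < M) z ^+ (8 * i) ^+ j.
  rewrite mulr_sumr; apply: eq_bigr => j _; rewrite -!exprM -exprD; congr (_ ^+ _).
  by lia.
have [zi|zi] := eqVneq (z ^+ (8 * i)) 1; last first.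
  exists 0, 0, 0, 0 => r _; rewrite sumE !mul0r !addr0 mulr0.
  have /eqP := subrX1 (z ^+ (8 * i)) M.
  rewrite -exprM mulnAC exprM (prim_expr_order z_prim) expr1n subrr eq_sym mulf_eq0.
  by rewrite subr_eq0 (negPf zi) /= => /eqP->; rewrite mulr0.
have : (m %| 8 * i)%N by rewrite (prim_order_dvd z_prim) zi.
rewrite dvdn_pmul2l // => /dvdnP[k iE].
(* Since [w ^+ (4 * r) = -1] for odd [r], reducing [k] modulo 4 costs only this sign, the same for
   every odd [r]. *)
pose a : int := (-1) ^+ (k %/ 4).
have wE r : odd r -> z ^+ (r * i) = a%:~R * w ^+ (k %% 4 * r).
  move=> r_odd; have -> : (r * i = M * ((4 * r) * (k %/ 4) + k %% 4 * r))%N.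
    rewrite iE {1}(divn_eq k 4); clear; nia.
  by rewrite exprM exprD exprM zeta8_pow_odd // /a rmorphXn rmorphN1.
have sum1 : \sum_(j < M) (1 : algC) ^+ j = M%:R.
  rewrite (eq_bigr (fun _ => 1)) => [|j _]; last by rewrite expr1n.
  by rewrite sumr_const card_ord.
have : (k %% 4 < 4)%N by rewrite ltn_mod.
move: (k %% 4)%N wE => b wE; case: b wE => [|[|[|[|//]]]] wE _.
- exists a, 0, 0, 0 => r r_odd; rewrite sumE zi sum1 wE //; rewrite mul0n; ring.
- exists 0, a, 0, 0 => r r_odd; rewrite sumE zi sum1 wE //; rewrite mul1n; ring.
- exists 0, 0, a, 0 => r r_odd; rewrite sumE zi sum1 wE //; ring.
- exists 0, 0, 0, a => r r_odd; rewrite sumE zi sum1 wE //; ring.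
Qed.

Lemma octave_sum_pev q : exists c0 c1 c2 c3 : int, forall r, odd r ->
  \sum_(j < M) pev q (z ^+ (8 * j + r)) =
  M%:R * (c0%:~R + c1%:~R * w ^+ r + c2%:~R * w ^+ (2 * r) + c3%:~R * w ^+ (3 * r)).
Proof.
rewrite -(coefK q) poly_def; elim/big_ind: _.
- exists 0, 0, 0, 0 => r _; rewrite big1 => [|j _]; first by ring.
  by rewrite (pevC 0).
- move=> q1 q2 [a0 [a1 [a2 [a3 qa]]]] [b0 [b1 [b2 [b3 qb]]]].
  exists (a0 + b0), (a1 + b1), (a2 + b2), (a3 + b3) => r r_odd.
  rewrite (eq_bigr _ (fun j _ => pevD q1 q2 _)) big_split /= qa // qb // !rmorphD /=.
  by ring.
move=> i _; have [a0 [a1 [a2 [a3 Xa]]]] := octave_sum_Xn i.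
exists (q`_i * a0), (q`_i * a1), (q`_i * a2), (q`_i * a3) => r r_odd.
transitivity ((q`_i)%:~R * \sum_(j < M) z ^+ (8 * j + r) ^+ i).
  by rewrite mulr_sumr; apply: eq_bigr => j _; rewrite -mul_polyC pevM pevC pevXn pevX.
by rewrite Xa // !rmorphM /=; ring.
Qed.

(** The sum for [r = 1] is real, which by the irrationality of sqrt 2 forces [c2 = 0] and
    [c3 = - c1]. *)
Lemma octave_sum_sqnorm q : exists A B : int, forall r, odd r ->
  \sum_(j < M) `|pev q (z ^+ (8 * j + r))| ^+ 2 =
  M%:R * (A%:~R + B%:~R * (w ^+ r - w ^+ (3 * r))).
Proof.
have [c0 [c1 [c2 [c3 E]]]] := octave_sum_pev (sqnorm_poly q).
have {}E r : odd r -> \sum_(j < M) `|pev q (z ^+ (8 * j + r))| ^+ 2 =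
  M%:R * (c0%:~R + c1%:~R * w ^+ r + c2%:~R * w ^+ (2 * r) + c3%:~R * w ^+ (3 * r)).
  by move=> /E <-; apply: eq_bigr => j _; rewrite pev_sqnorm.
have MC : M%:R != 0 :> algC by rewrite pnatr_eq0 -lt0n.
have realS : (\sum_(j < M) `|pev q (z ^+ (8 * j + 1))| ^+ 2)^* =
    \sum_(j < M) `|pev q (z ^+ (8 * j + 1))| ^+ 2.
  by apply/CrealP; rewrite realE sumr_ge0 // => j _; rewrite exprn_ge0.
move: realS; rewrite E // rmorphM rmorph_nat => /(mulfI MC).
have conj_zeta8X k : (w ^+ k)^* = (- w ^+ 3) ^+ k by rewrite rmorphXn /= conj_zeta8.
rewrite !rmorphD !rmorphM !rmorph_int /= !conj_zeta8X !muln1 => real1.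
have [c20 c13] : 2 * c2 = 0 /\ c1 + c3 = 0.
  apply: (algC_sqrt2_irrational (s := - s)); first by rewrite sqrrN sqrt2_sqr.
  move: (z ^+ M) zeta8_pow4 real1 => x x4 real1.
  have /eqP := real1; rewrite -subr_eq0 => /eqP {}real1.
  (* Multiplied by [w ^+ 2], the difference of the sum and its conjugate becomes, up to sign,
     [2 * c2 + (c1 + c3) * s]. *)
  have : x ^+ 2 * 0 = c1%:~R * (- x ^+ 4 * x - x ^+ 3) + c2%:~R * (x ^+ 4 * x ^+ 4 - x ^+ 4)
      + c3%:~R * (- x ^+ 4 * x ^+ 4 * x ^+ 3 - x ^+ 4 * x) by rewrite -[in LHS]real1; ring.
  by rewrite x4 mulr0 !rmorphD rmorphM /= => x0; rewrite -[LHS]subr0 x0; ring.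
exists c0, c1 => r r_odd; rewrite E //.
have -> : c2 = 0 by clear -c20; lia.
have -> : c3 = - c1 by clear -c13; lia.
by rewrite rmorphN; ring.
Qed.

End Cyclotomic.

(** The norm is the product of the two conjugates, and it is nonzero by the irrationality of sqrt
    2. *)
Lemma form_gt0 (s : algC) (A B : int) : s ^+ 2 = 2 -> A != 0 ->
  0 <= A%:~R + B%:~R * s -> 0 <= A%:~R - B%:~R * s -> 0 < A ^+ 2 - 2 * B ^+ 2.
Proof.
move=> s2 A0 ge0 ge0'; rewrite lt_neqAle; apply/andP; split.
  rewrite eq_sym subr_eq0; apply: contra_neqN A0 => /eqP; exact: sqrt2_irrational.
rewrite -(ler0z algC) rmorphB [X in _ - X]rmorphM !rmorphXn /=.
have -> : (A%:~R ^+ 2 - 2 * B%:~R ^+ 2 : algC) =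
  (A%:~R + B%:~R * s) * (A%:~R - B%:~R * s) by rewrite -s2; ring.
exact: mulr_ge0.
Qed.

(** * The embedding norm on the ideal and the lower bound *)

Section TwoPower.
Variables (e : nat) (z : algC).
Local Notation M := (2 ^ e)%N.
Hypothesis z_prim : (8 * M).-primitive_root z.
Local Notation m := (8 * M)%N.
Local Notation w := (z ^+ M).
Local Notation s := (w - w ^+ 3).

Let M0 : (0 < M)%N. Proof. by rewrite expn_gt0. Qed.

Lemma coprime_octave k : coprime k m = odd k.
Proof. by rewrite -[8%N]/(2 ^ 3)%N -expnD coprime_pexpr // coprimen2. Qed.

(** The classes 1 and 7 modulo 8 contribute [A + B s] and the classes 3 and 5 contribute [A - B s],
    so the irrational parts cancel. *)
Lemma emb_norm_octaves q (A B : int) :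
  (forall r, odd r -> \sum_(j < M) `|pev q (z ^+ (8 * j + r))| ^+ 2 =
     M%:R * (A%:~R + B%:~R * (w ^+ r - w ^+ (3 * r)))) ->
  emb_norm m z q ^+ 2 = (4 * M)%:R * A%:~R.
Proof.
move=> sumE; rewrite sqrtCK.
rewrite (eq_bigl (fun k : 'I_m => odd k)) => [|k]; last exact: coprime_octave.
rewrite (sum_octaves M (fun k => `|pev q (z ^+ k)| ^+ 2)) !big_split /=.
rewrite !sumE //; have [-> -> ->] := sqrt2_conjugates M0 z_prim.
by rewrite natrM; ring.
Qed.

Lemma emb_norm_gt0 q : pev q z != 0 -> 0 < emb_norm m z q ^+ 2.
Proof.
move=> q0; rewrite sqrtCK.
have m1 : (1 < m)%N by clear -M0; lia.
rewrite (bigD1 (Ordinal m1)) ?coprime1n //= ltr_wpDr //.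
  by apply: sumr_ge0 => k _; exact: exprn_ge0.
by rewrite expr1 exprn_gt0 // normr_gt0.
Qed.

(** The automorphisms sending [z] to [z ^+ k] commute with complex conjugation, so every squared
    absolute value is a conjugate of [A + B s]. *)
Lemma emb_norm_sqnorm q (A B : int) :
  pev q z * (pev q z)^* = A%:~R + B%:~R * s ->
  emb_norm m z q ^+ 2 = (4 * M)%:R * A%:~R /\
  (pev q z != 0 -> 0 < A /\ 0 < A ^+ 2 - 2 * B ^+ 2).
Proof.
move=> normE.
have sqE k : odd k -> `|pev q (z ^+ k)| ^+ 2 = A%:~R + B%:~R * (w ^+ k - w ^+ (3 * k)).
  rewrite -coprime_octave => /Qn_aut_exists[u uE].
  have uz : u z = z ^+ k by rewrite uE // (prim_expr_order z_prim).
  rewrite -(pev_sqnorm M0 z_prim) -uz -pev_rmorph -[z in pev _ z]expr1.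
  rewrite (pev_sqnorm M0 z_prim) normCK.
  rewrite expr1 normE rmorphD rmorphM !rmorph_int rmorphB !rmorphXn /= uz.
  by congr (_ + _ * (_ - _)); rewrite -!exprM; congr (_ ^+ _); clear; lia.
have emb : emb_norm m z q ^+ 2 = (4 * M)%:R * A%:~R.
  apply: (@emb_norm_octaves q A B) => r r_odd.
  rewrite (eq_bigr (fun _ => A%:~R + B%:~R * (w ^+ r - w ^+ (3 * r)))) => [|j _].
    by rewrite sumr_const card_ord mulr_natl.
  have wX a b : w ^+ (8 * a + b) = w ^+ b.
    have -> : w ^+ (8 * a + b) = z ^+ m ^+ a * w ^+ b.
      by rewrite exprD -!exprM; congr (z ^+ _ * _); clear; lia.
    by rewrite (prim_expr_order z_prim) expr1n mul1r.
  rewrite sqE; last by rewrite oddD oddM.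
  have -> : (3 * (8 * j + r) = 8 * (3 * j) + 3 * r)%N by clear; lia.
  by rewrite !wX.
split=> // q0; have A0 : 0 < A.
  have := emb_norm_gt0 q0; rewrite emb pmulr_rgt0 ?ltr0z //.
  by rewrite ltr0n muln_gt0.
split=> //; apply: (form_gt0 (sqrt2_sqr M0 z_prim)); first by rewrite gt_eqF.
  by rewrite -normE -normCK exprn_ge0.
have := sqE 3%N isT; have [-> _ _] := sqrt2_conjugates M0 z_prim.
by rewrite mulrN => <-; rewrite exprn_ge0.
Qed.

Variables (p : nat) (P : algC -> Prop).
Hypotheses (p_pr : prime p) (p_odd : odd p).
Hypotheses (Pprime : is_prime_ideal z P) (Pover : lies_over P p).

Lemma ideal_nat k : P k%:R -> (p %| k)%N.
Proof. by move=> Pk; have /Pover : P (k%:Z)%:~R. Qed.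

Lemma inZz_sqrt2 : inZz z s.
Proof. by apply: inZzB; do ?apply: inZzX; apply: inZz_gen. Qed.

Lemma ideal_form (A B : int) : P (A%:~R + B%:~R * s) -> (p %| A ^+ 2 - 2 * B ^+ 2)%Z.
Proof.
move=> PAB; apply/(ideal_int Pover).
have := @idealMl z P Pprime (A%:~R - B%:~R * s) _ _ PAB.
have -> : (A%:~R - B%:~R * s) * (A%:~R + B%:~R * s) = (A ^+ 2 - 2 * B ^+ 2)%:~R.
  transitivity (A%:~R ^+ 2 - s ^+ 2 * B%:~R ^+ 2 : algC); first by ring.
  by rewrite (sqrt2_sqr M0 z_prim) rmorphB [X in _ = _ - X]rmorphM !rmorphXn.
by apply; apply: inZzB; [exact: inZz_int | apply: inZzM; [exact: inZz_int | exact: inZz_sqrt2]].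
Qed.

(* The two residues of [p] modulo 16 are treated at once: by complex conjugation,
   the sign of [p] modulo [m] is immaterial below. *)
Variable u : int.
Hypothesis pu : p%:Z = 9 + 16 * u \/ - p%:Z = 9 + 16 * u.

(** By [pow_1mod8], [8 * j + 1] is modulo [m] a power of [p] or of [- p]. An odd power of [- p]
    inverts [z ^+ (p ^ i)], and inversion is conjugation on roots of unity. *)
Lemma frobenius_orbit j : exists i : nat,
  z ^+ (8 * j + 1) = z ^+ (p ^ i) \/ z ^+ (8 * j + 1) = (z ^+ (p ^ i))^*.
Proof.
have [i [t E]] := pow_1mod8 u j (3 + e); exists i.
have {}E : (m %| (9 + 16 * u) ^+ i - (8 * j + 1)%N%:Z)%Z.
  apply/dvdzP; exists t; rewrite PoszD PoszM E mulrC; congr (_ * _).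
  by rewrite exprD PoszM; congr (_ * _); elim: e => // k; rewrite expnS PoszM exprS => <-.
have same : (9 + 16 * u) ^+ i = p%:Z ^+ i -> z ^+ (8 * j + 1) = z ^+ (p ^ i).
  move=> pi; apply/esym/eqP; rewrite (eq_prim_root_expr z_prim).
  by move: E; rewrite pi -eqz_mod_dvd -rmorphXn /= !modz_nat.
case: pu => pE; first by left; apply: same; rewrite pE.
have signE : (9 + 16 * u) ^+ i = (-1) ^+ odd i * p%:Z ^+ i.
  by rewrite signr_odd -pE [LHS]exprNn.
case: (boolP (odd i)) => i_odd; last by left; apply: same; rewrite signE (negPf i_odd) mul1r.
right; move: E; rewrite signE i_odd expr1 mulN1r -opprD dvdzE abszN => E.
have zz : z ^+ (p ^ i) * z ^+ (8 * j + 1) = 1.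
  by apply/eqP; rewrite -exprD -(prim_order_dvd z_prim); move: E; rewrite -rmorphXn.
have zi : z ^+ (p ^ i) ^+ m = 1 by rewrite exprAC (prim_expr_order z_prim) expr1n.
have z0 : z ^+ (p ^ i) != 0 by apply: contra_eq_neq zz => ->; rewrite mul0r eq_sym oner_neq0.
by rewrite (conj_unity_root _ zi) ?muln_gt0 //; apply: (mulfI z0); rewrite zz mulfV.
Qed.

(** Conjugation preserves absolute values, so it suffices to iterate the Frobenius stability of
    [P]. *)
Lemma ideal_sqnorm q j : P (pev q z) -> P (`|pev q (z ^+ (8 * j + 1))| ^+ 2).
Proof.
move=> Pq; have [i zi] := frobenius_orbit j.
have -> : `|pev q (z ^+ (8 * j + 1))| = `|pev q (z ^+ (p ^ i))|.
  by case: zi => ->; rewrite -?conj_pev ?norm_conjC.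
have Zq : inZz z (pev q (z ^+ (p ^ i))) by apply/inZz_pev/inZzX/inZz_gen.
rewrite normCK mulrC; apply: (idealMl Pprime); first exact: (inZz_conj M0 z_prim).
elim: i {zi Zq} => [|i IHi]; first by rewrite expn0 expr1.
by rewrite expnSr; apply: (ideal_frobenius p_pr Pprime Pover).
Qed.

Lemma ideal_emb_norm q : P (pev q z) -> pev q z != 0 -> exists A B : int,
  [/\ emb_norm m z q ^+ 2 = (4 * M)%:R * A%:~R, 0 < A,
      0 < A ^+ 2 - 2 * B ^+ 2 & (p %| A ^+ 2 - 2 * B ^+ 2)%Z].
Proof.
move=> Pq q0; have [A [B sumE]] := octave_sum_sqnorm M0 z_prim q.
have MC : 0 < M%:R :> algC by rewrite ltr0n.
have ge0 r : odd r -> 0 <= A%:~R + B%:~R * (w ^+ r - w ^+ (3 * r)).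
  move=> r_odd; rewrite -(pmulr_rge0 _ MC) -sumE // sumr_ge0 // => j _.
  exact: exprn_ge0.
have s1 := ge0 1%N isT; have s3 := ge0 3%N isT; have [w3 _ _] := sqrt2_conjugates M0 z_prim.
rewrite w3 mulrN in s3; rewrite !muln1 expr1 in s1.
have emb := emb_norm_octaves sumE.
have A0 : 0 < A.
  have := emb_norm_gt0 q0; rewrite emb pmulr_rgt0 ?ltr0z //.
  by rewrite ltr0n muln_gt0.
exists A, B; split=> //; first by apply: (form_gt0 (sqrt2_sqr M0 z_prim)); rewrite ?gt_eqF.
apply: ideal_form.
(* [M] is a power of 2 and [p] is odd, so the prime ideal [P] lets the factor [M] be cancelled. *)
have : P (M%:R * (A%:~R + B%:~R * s)).
  have := sumE 1%N isT; rewrite !muln1 expr1 => <-; apply: (ideal_sum Pprime) => j _.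
  exact: ideal_sqnorm.
case/(prime_idealM Pprime) => //; first exact: (inZz_int z M%:Z).
  by apply: inZzD; [exact: inZz_int | apply: inZzM; [exact: inZz_int | exact: inZz_sqrt2]].
move=> /ideal_nat; rewrite Euclid_dvdX // dvdn_prime2 // => /andP[/eqP p2 _].
by have := p_odd; rewrite p2.
Qed.

End TwoPower.

(** * Short elements of the ideal *)

Lemma form_inj (s : algC) (A B C D : int) : s ^+ 2 = 2 ->
  A%:~R + B%:~R * s = C%:~R + D%:~R * s -> A = C /\ B = D.
Proof.
move=> s2 E; have [AC BD] : A - C = 0 /\ D - B = 0.
  apply: (algC_sqrt2_irrational s2); rewrite !rmorphB /=.
  transitivity (A%:~R + B%:~R * s - C%:~R - B%:~R * s); first by ring.
  by rewrite E; ring.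
by split; [apply/eqP | apply/esym/eqP]; rewrite -subr_eq0 ?AC ?BD.
Qed.

Section Existence.
Variables (e : nat) (z : algC) (p : nat) (P : algC -> Prop).
Local Notation M := (2 ^ e)%N.
Local Notation m := (8 * M)%N.
Hypothesis z_prim : m.-primitive_root z.
Hypotheses (p_pr : prime p) (p_odd : odd p) (p7 : (7 <= p)%N).
Hypotheses (Pprime : is_prime_ideal z P) (Pover : lies_over P p).
Local Notation w := (z ^+ M).
Local Notation s := (w - w ^+ 3).

Let M0 : (0 < M)%N. Proof. by rewrite expn_gt0. Qed.
Let s2 : s ^+ 2 = 2. Proof. exact: sqrt2_sqr M0 z_prim. Qed.
Let Zs : inZz z s. Proof. exact: inZz_sqrt2. Qed.

Lemma conj_sqrt2 : s^* = s.
Proof.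
have := conj_zeta8 M0 z_prim; have := zeta8_pow4 M0 z_prim; move: (z ^+ M) => x x4 cx.
rewrite rmorphB rmorphXn /= cx.
have -> : (- x ^+ 3) ^+ 3 = - (x ^+ 4 * x ^+ 4 * x) by ring.
by rewrite x4; ring.
Qed.

Lemma ideal_not2 : ~ P 2.
Proof.
move=> /(ideal_nat Pover); rewrite dvdn_prime2 // => /eqP p2.
by move: p_odd; rewrite p2.
Qed.

Lemma ideal_form_neq0 x (A B : int) : x * x^* = A%:~R + B%:~R * s -> 0 < A -> x != 0.
Proof.
move=> xE A0; apply: contraTneq A0 => x0; move: xE; rewrite x0 mul0r => E.
have [<- _] : 0 = A /\ 0 = B by apply: (form_inj s2); rewrite mul0r addr0.
by rewrite ltxx.
Qed.

Lemma form_norm_gt0 x (A B : int) : P x -> x * x^* = A%:~R + B%:~R * s -> x != 0 ->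
  0 < A /\ 0 < A ^+ 2 - 2 * B ^+ 2.
Proof.
move=> /(ideal_inZz Pprime)[q ->] xE.
by have [_] := emb_norm_sqnorm z_prim xE.
Qed.

(* While [A ^+ 2 > 2 * p], multiplying by one of the units [1 + s], [1 - s] reduces [A]. *)
Lemma unit_descent x (A B : int) :
  P x -> x * x^* = A%:~R + B%:~R * s -> 0 < A -> A ^+ 2 - 2 * B ^+ 2 = p%:Z ->
  exists y (C D : int), [/\ P y, y * y^* = C%:~R + D%:~R * s, 0 < C,
    C ^+ 2 - 2 * D ^+ 2 = p%:Z & C ^+ 2 <= 2 * p%:Z].
Proof.
have [k] := ubnP (absz A); elim: k x A B => // k IHk x A B ltAk Px xE A0 ABp.
have [small|big] := leP (A ^+ 2) (2 * p%:Z); first by exists x, A, B.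
have p0 : 0 < p%:Z by rewrite ltz_nat prime_gt0.
have /andP[] := pell_reduce p0 A0 ABp big.
(* [t] is a sign of [B]. The unit [1 - t s] is real, so [x * x^*] is multiplied by its square
   [3 - 2 t s], the reduction of [pell_reduce]. *)
pose t : int := if 0 <= B then 1 else -1.
have tB : `|B| = t * B.
  rewrite /t; case: (leP 0 B) => B0; first by rewrite ger0_norm // mul1r.
  by rewrite ltr0_norm // mulN1r.
have t2 : t ^+ 2 = 1 by rewrite /t; case: ifP.
rewrite tB => C0 CA.
apply: (IHk ((1 - t%:~R * s) * x) (3 * A - 4 * (t * B)) (3 * B - 2 * t * A) _ _ _ C0).
- by move: ltAk CA C0; clear; lia.
- apply: (idealMl Pprime) => //; apply: inZzB; first exact: inZz1.
  by apply: inZzM => //; apply: inZz_int.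
- rewrite rmorphM rmorphB rmorph1 rmorphM rmorph_int /= conj_sqrt2.
  transitivity ((1 + t%:~R ^+ 2 * s ^+ 2 - 2 * t%:~R * s) * (x * x^*)); first by ring.
  have tC : (t%:~R : algC) ^+ 2 = 1 by rewrite -rmorphXn /= t2.
  rewrite xE tC s2.
  transitivity (3 * A%:~R - 2 * t%:~R * B%:~R * s ^+ 2 + (3 * B%:~R - 2 * t%:~R * A%:~R) * s).
    by ring.
  by rewrite s2 !rmorphB !rmorphM /=; ring.
- transitivity ((9 - 8 * t ^+ 2) * A ^+ 2 + (16 * t ^+ 2 - 18) * B ^+ 2); first by ring.
  by rewrite t2 -ABp; ring.
Qed.

(* [Q] is the ring of integers of the decomposition field of [p], a quadratic
   extension of Q(sqrt 2), and [pi] is its prime element above 2. *)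
Variables (Q : algC -> Prop) (pi : algC).
Hypothesis QZ : forall x, Q x -> inZz z x.
Hypothesis Qform : forall x, Q x -> exists A B : int, x * x^* = A%:~R + B%:~R * s.
Hypotheses (Zpi : inZz z pi) (pi_norm : pi * pi^* = 2 - s).
Hypothesis Qhalf : forall x (A B : int), Q x -> x * x^* = A%:~R + B%:~R * s ->
  (2%N %| A)%Z -> exists2 y, Q y & x = pi * y.

(** [2 = (2 + s) (2 - s)] is a multiple of [pi], and 2 is not in [P]. *)
Lemma ideal_pi : ~ P pi.
Proof.
move=> Ppi; apply: ideal_not2.
have -> : 2 = (2 + s) * (pi^* * pi).
  rewrite [pi^* * _]mulrC pi_norm; transitivity (4 - s ^+ 2); first by rewrite s2; ring.
  by ring.
have Zpi' := inZz_conj M0 z_prim Zpi.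
apply: (idealMl Pprime); last exact: (idealMl Pprime).
by apply: inZzD => //; apply: (inZz_int z 2).
Qed.

(** Dividing [x] by [pi] divides [A + B s] by [2 - s], of norm 2, and so halves [k]; the quotient
    stays in [P] because [pi] is outside it. *)
Lemma norm_descent (k : int) x (A B : int) :
  Q x -> P x -> x * x^* = A%:~R + B%:~R * s -> 0 < k < 7 -> A ^+ 2 - 2 * B ^+ 2 = k * p%:Z ->
  exists y (C D : int), [/\ P y, y * y^* = C%:~R + D%:~R * s & C ^+ 2 - 2 * D ^+ 2 = p%:Z].
Proof.
have [d] := ubnP (absz k); elim: d k x A B => // d IHd k x A B ltkd Qx Px xE k7 ABk.
have [k1|[l kE A2]] := norm_multiplier p_pr p7 k7 ABk.
  by exists x, A, B; rewrite ABk k1 mul1r.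
have [y Qy xy] := Qhalf Qx xE A2.
have [C [D yE]] := Qform Qy.
have Py : P y.
  by case: (prime_idealM Pprime Zpi (QZ Qy)); rewrite -?xy // => /ideal_pi.
have [AC BD] : A = 2 * C - 2 * D /\ B = 2 * D - C.
  apply: (form_inj s2); rewrite -xE xy rmorphM mulrACA pi_norm yE /=.
  transitivity (2 * C%:~R - D%:~R * s ^+ 2 + (2 * D%:~R - C%:~R) * s); first by ring.
  by rewrite s2 !rmorphB !rmorphM /=; ring.
have CDl : C ^+ 2 - 2 * D ^+ 2 = l * p%:Z.
  by move: ABk; rewrite AC BD kE; clear; lia.
apply: (IHd l y C D) => //; move: ltkd k7; rewrite kE; clear; lia.
Qed.

(** The bound on [A] gives a multiplier below 7; [norm_descent] brings it to 1 and [unit_descent]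
    then makes the element reduced. *)
Lemma ideal_short x (A B : int) : Q x -> P x -> x * x^* = A%:~R + B%:~R * s -> 0 < A ->
  A ^+ 2 < 7 * p%:Z ->
  exists y (C D : int), [/\ P y, y * y^* = C%:~R + D%:~R * s, 0 < C,
    C ^+ 2 - 2 * D ^+ 2 = p%:Z & C ^+ 2 <= 2 * p%:Z].
Proof.
move=> Qx Px xE A0 A7.
have [_ N0] := form_norm_gt0 Px xE (ideal_form_neq0 xE A0).
have PAB : P (A%:~R + B%:~R * s).
  by rewrite -xE mulrC; apply: (idealMl Pprime) => //; exact: (inZz_conj M0 z_prim (QZ Qx)).
have /dvdzP[k kE] := ideal_form z_prim Pprime Pover PAB.
have p0 : 0 < p%:Z by rewrite ltz_nat prime_gt0.
have k7 : 0 < k < 7.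
  rewrite -(pmulr_lgt0 k p0) -kE N0 -(ltr_pM2r p0) -kE /=.
  by apply: le_lt_trans A7; rewrite gerBl mulr_ge0 ?sqr_ge0.
have [y [C [D [Py yE CDp]]]] := norm_descent Qx Px xE k7 kE.
have y0 : y != 0.
  apply/eqP=> y0; move: yE; rewrite y0 mul0r => E.
  have [C0 D0] : 0 = C /\ 0 = D by apply: (form_inj s2); rewrite mul0r addr0.
  by move: p0; rewrite -CDp -C0 -D0.
have [C0 _] := form_norm_gt0 Py yE y0.
exact: unit_descent Py yE C0 CDp.
Qed.

End Existence.

Lemma even_of_sqr_even (a b : int) : (2%N %| a)%Z -> a = b ^+ 2 -> exists t, b = 2 * t.
Proof.
move=> a2 ab; have : (2%N %| b * b)%Z by rewrite -expr2 -ab.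
by case/Euclid_dvdz=> // /dvdzP[t ->]; exists t; rewrite mulrC.
Qed.

Lemma conj_comb (f1 f2 f3 : algC) (x0 x1 x2 x3 : int) :
  (x0%:~R + x1%:~R * f1 + x2%:~R * f2 + x3%:~R * f3)^*
  = x0%:~R + x1%:~R * f1^* + x2%:~R * f2^* + x3%:~R * f3^*.
Proof.
have conjZ (c : int) (f : algC) : (c%:~R * f)^* = c%:~R * f^*.
  by rewrite rmorphM rmorph_int.
by rewrite !rmorphD /= !conjZ rmorph_int.
Qed.

Definition int_comb (f1 f2 f3 x : algC) : Prop := exists x0 x1 x2 x3 : int,
  x = x0%:~R + x1%:~R * f1 + x2%:~R * f2 + x3%:~R * f3.

(** * Short elements for p = 9 and p = 7 modulo 16 *)

Section Cases.
Variables (e : nat) (z : algC) (p : nat) (P : algC -> Prop).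
Local Notation M := (2 ^ e)%N.
Local Notation m := (8 * M)%N.
Hypothesis z_prim : m.-primitive_root z.
Hypotheses (p_pr : prime p) (p_odd : odd p) (p7 : (7 <= p)%N).
Hypotheses (Pprime : is_prime_ideal z P) (Pover : lies_over P p).
Local Notation w := (z ^+ M).
Local Notation s := (w - w ^+ 3).

Let M0 : (0 < M)%N. Proof. by rewrite expn_gt0. Qed.
Let s2 : s ^+ 2 = 2. Proof. exact: sqrt2_sqr M0 z_prim. Qed.
Let Zw : inZz z w. Proof. by apply/inZzX/inZz_gen. Qed.
Let w44 : w ^+ 4 = -1. Proof. exact: zeta8_pow4 M0 z_prim. Qed.

Lemma inZz_comb f1 f2 f3 x : inZz z f1 -> inZz z f2 -> inZz z f3 -> int_comb f1 f2 f3 x -> inZz z x.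
Proof.
by move=> Z1 Z2 Z3 [x0 [x1 [x2 [x3 ->]]]]; do ![apply: inZzD | apply: inZzM | apply: inZz_int].
Qed.

(* [B] is the coefficient of [s] in the relative norm of a combination; the
   coefficient of 1 is a diagonal form, to which Hermite's inequality applies. *)
Lemma comb_short (c : int) f1 f2 f3 (a1 a2 a3 : int) (B : int -> int -> int -> int -> int) pi :
  0 < c <= 2 -> inZz z f1 -> inZz z f2 -> inZz z f3 ->
  P (f1 - a1%:~R) -> P (f2 - a2%:~R) -> P (f3 - a3%:~R) ->
  (forall x0 x1 x2 x3 : int, let x := x0%:~R + x1%:~R * f1 + x2%:~R * f2 + x3%:~R * f3 in
     x * x^* = (x0 ^+ 2 + c * (x1 ^+ 2 + x2 ^+ 2 + x3 ^+ 2))%:~R + (B x0 x1 x2 x3)%:~R * s) ->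
  inZz z pi -> pi * pi^* = 2 - s ->
  (forall x0 x1 x2 x3 : int, (2%N %| x0 ^+ 2 + c * (x1 ^+ 2 + x2 ^+ 2 + x3 ^+ 2))%Z ->
     exists2 y, int_comb f1 f2 f3 y & x0%:~R + x1%:~R * f1 + x2%:~R * f2 + x3%:~R * f3 = pi * y) ->
  exists y (C D : int), [/\ P y, y * y^* = C%:~R + D%:~R * s, 0 < C,
    C ^+ 2 - 2 * D ^+ 2 = p%:Z & C ^+ 2 <= 2 * p%:Z].
Proof.
move=> c2 Z1 Z2 Z3 P1 P2 P3 form Zpi pi_norm half.
have c0 : 0 < c by case/andP: c2.
have [x0 [x1 [x2 [x3 [px A0 bound]]]]] := short_vector a1 a2 a3 c0 (prime_gt0 p_pr).
apply: (@ideal_short e z p P z_prim p_pr p_odd p7 Pprime Pover (int_comb f1 f2 f3) pi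
  _ _ Zpi pi_norm _ _ _ (B x0 x1 x2 x3) _ _ (form x0 x1 x2 x3) A0).
- by move=> x; apply: inZz_comb.
- move=> x [y0 [y1 [y2 [y3 ->]]]]; do 2!eexists; exact: form.
- move=> x A' B' [y0 [y1 [y2 [y3 ->]]]]; rewrite form => /(form_inj s2)[<- _].
  exact: half.
- by exists x0, x1, x2, x3.
- exact: (ideal_lattice Pprime Pover P1 P2 P3).
- exact: (short_bound (prime_gt0 p_pr) c2 bound).
Qed.

(** Here [p] is 1 modulo 8, so the Frobenius map fixes [w]. In the basis of powers of [w] the
    coefficient of 1 in [x * x^*] is a sum of four squares, and the prime above 2 is [1 - w]. *)
Lemma short_9mod16 : (p %% 16 = 9)%N ->
  exists y (C D : int), [/\ P y, y * y^* = C%:~R + D%:~R * s, 0 < C,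
    C ^+ 2 - 2 * D ^+ 2 = p%:Z & C ^+ 2 <= 2 * p%:Z].
Proof.
move=> p9; have cw := conj_zeta8 M0 z_prim.
have [a Pa] : exists a : int, P (w - a%:~R).
  apply: (ideal_residue p_pr Pprime Pover) => //.
  have -> : w ^+ p = w.
    have -> : p = (4 * (2 * (2 * (p %/ 16) + 1)) + 1)%N.
      by move: (divn_eq p 16); rewrite p9; clear; lia.
    by rewrite exprD exprM w44 exprM sqrrN !expr1n mul1r.
  by rewrite subrr; case: Pprime => [[]].
have Pa2 : P (w ^+ 2 - (a * a)%:~R) by apply: (ideal_congM Pprime).
have Pa3 : P (w ^+ 3 - (a * (a * a))%:~R).
  by rewrite exprS; apply: (ideal_congM Pprime).
apply: (comb_short (c := 1) (pi := 1 - w)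
  (B := fun x0 x1 x2 x3 => x0 * x1 + x1 * x2 + x2 * x3 - x0 * x3)
  _ Zw _ _ Pa Pa2 Pa3) => //.
- exact: inZzX.
- exact: inZzX.
- move=> x0 x1 x2 x3 y; rewrite {}/y; move: (z ^+ M) cw w44 => x cx x4.
  have c2 : (x ^+ 2)^* = - x ^+ 2.
    rewrite rmorphXn /= cx.
    by transitivity (x ^+ 4 * x ^+ 2); [ring | rewrite x4; ring].
  have c3 : (x ^+ 3)^* = - x.
    rewrite rmorphXn /= cx.
    by transitivity (- (x ^+ 4 * x ^+ 4 * x)); [ring | rewrite x4; ring].
  rewrite conj_comb cx c2 c3.
  transitivity (x0%:~R ^+ 2 + (x0%:~R * x1%:~R - x0%:~R * x3%:~R) * (x - x ^+ 3)
    - x ^+ 4 * (x1%:~R ^+ 2 + x2%:~R ^+ 2 + x3%:~R ^+ 2)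
    - (x1%:~R * x2%:~R + x2%:~R * x3%:~R) * (x ^+ 3 + x ^+ 4 * x)
    - x1%:~R * x3%:~R * (x ^+ 2 + x ^+ 4 * x ^+ 2)); first by ring.
  by rewrite x4 !rmorphB !rmorphD !rmorphM /=; ring.
- by apply: inZzB; [exact: inZz1 | ].
- move: (z ^+ M) cw w44 => x cx x4; rewrite rmorphB rmorph1 /= cx.
  transitivity (1 - x + x ^+ 3 - x ^+ 4); first by ring.
  by rewrite x4; ring.
move=> x0 x1 x2 x3 A2.
(* Modulo 2 the sum of squares is the square of [x0 + x1 + x2 + x3]. *)
have [t tE] : exists t, x0 + x1 + x2 + x3 = 2 * t.
  apply: (@even_of_sqr_even (x0 ^+ 2 + 1 * (x1 ^+ 2 + x2 ^+ 2 + x3 ^+ 2) +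
     2 * (x0 * x1 + x0 * x2 + x0 * x3 + x1 * x2 + x1 * x3 + x2 * x3))); last by ring.
  by rewrite rpredD // dvdz_mulr.
(* Division by [1 - w] produces partial sums of the coefficients, shifted by [t] because
   [w ^+ 4 = -1]. *)
exists ((x0 - t)%:~R + (x1 + x0 - t)%:~R * w + (x2 + x1 + x0 - t)%:~R * w ^+ 2 + t%:~R * w ^+ 3).
  by do 4!eexists.
have -> : x3 = 2 * t - x0 - x1 - x2 by rewrite -tE; ring.
move: (z ^+ M) w44 => x x4; rewrite !rmorphB !rmorphD !rmorphM /=.
transitivity (x0%:~R - t%:~R - x ^+ 4 * t%:~R + x1%:~R * x + x2%:~R * x ^+ 2
  + (2 * t%:~R - x0%:~R - x1%:~R - x2%:~R) * x ^+ 3).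
  by rewrite x4; ring.
by ring.
Qed.

(** [0 < e] provides the 16th root of unity [v]. For real [x] and [y] in Z[s], the product of
    [x + y th] with its conjugate is [x^2 + (2 - s) y^2]. *)
Lemma short_7mod16 : (0 < e)%N -> (p %% 16 = 7)%N ->
  exists y (C D : int), [/\ P y, y * y^* = C%:~R + D%:~R * s, 0 < C,
    C ^+ 2 - 2 * D ^+ 2 = p%:Z & C ^+ 2 <= 2 * p%:Z].
Proof.
move=> e0 p7'; have [v vw Zv] : exists2 v, v ^+ 2 = w & inZz z v.
  exists (z ^+ (2 ^ e.-1)); first by rewrite -exprM -expnSr prednK.
  by apply/inZzX/inZz_gen.
have v8 : v ^+ 8 = -1 by rewrite (exprM v 2 4) vw.
have v16 : v ^+ 16 = 1 by rewrite (exprM v 8 2) v8 sqrrN expr1n.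
have cv : v^* = - v ^+ 7.
  have v0 : v != 0 by apply: contra_eq_neq v16 => ->; rewrite expr0n eq_sym oner_neq0.
  by rewrite (conj_unity_root _ v16) //; apply: (mulfI v0); rewrite mulfV // mulrN -exprS v8 opprK.
(* [v ^+ 7] is [- v^-1], so [th] generates the field fixed by [v |-> v ^+ 7]. *)
pose th := v + v ^+ 7.
have Zth : inZz z th by apply: inZzD => //; apply: inZzX.
have th2 : th ^+ 2 = s - 2.
  rewrite -vw /th; transitivity (v ^+ 2 + 2 * v ^+ 8 + v ^+ 8 * v ^+ 6); first by ring.
  by rewrite v8; ring.
have cth : th^* = - th.
  rewrite /th rmorphD rmorphXn /= cv.
  transitivity (- v ^+ 7 - v ^+ 16 * v ^+ 16 * v ^+ 16 * v); first by ring.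
  by rewrite v16; ring.
have [a Pa] : exists a : int, P (th - a%:~R).
  apply: (ideal_residue p_pr Pprime Pover) => //.
  (* The Frobenius map sends [v + v ^+ 7] to [v ^+ 7 + v ^+ 49], and [v ^+ 49 = v]. *)
  have := ideal_frobenius_sub p_pr Pprime Pover ('X + 'X^7) Zv.
  rewrite !pevD !pevXn !pevX -/th; congr (P (_ - _)).
  rewrite (divn_eq p 16) p7' exprD mulnC exprM v16 expr1n mul1r addrC.
  by congr (_ + _); rewrite -exprM (exprD v 48 1) (exprM v 16 3) v16 expr1n mul1r.
have Ps : P (s - (a * a + 2)%:~R).
  have -> : s - (a * a + 2)%:~R = th * th - (a * a)%:~R.
    by rewrite -[th * th]expr2 th2 rmorphD /=; ring.
  exact: (ideal_congM Pprime).
have Ps1 : P (1 + s - (a * a + 3)%:~R).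
  by move: Ps; congr P; rewrite !rmorphD /=; ring.
have Zs : inZz z s by apply: (inZz_sqrt2 _ z).
have Zs1 : inZz z (1 + s) by apply: inZzD => //; apply: inZz1.
have cs := conj_sqrt2 z_prim.
have cf3 : ((1 + s) * th)^* = - ((1 + s) * th).
  by rewrite rmorphM rmorphD rmorph1 /= cs cth mulrN.
(* The basis element [(1 + s) * th] in place of [s * th] removes the cross term from the coefficient
   of 1. *)
apply: (comb_short (c := 2) (pi := th) (f3 := (1 + s) * th)
  (B := fun x0 x1 x2 x3 => 2 * x0 * x1 + x3 ^+ 2 + 2 * x2 * x3 - x2 ^+ 2)
  _ Zs Zth _ Ps Pa (ideal_congM Pprime Zs1 Ps1 Pa)) => //.
- exact: inZzM.
- move=> x0 x1 x2 x3 y; rewrite {}/y conj_comb cs cth cf3.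
  move: s s2 th th2 {cth cf3 cs Zth Zs Zs1 Pa Ps Ps1} => r r2 t t2.
  transitivity ((x0%:~R + x1%:~R * r) ^+ 2 - t ^+ 2 * (x2%:~R + x3%:~R * (1 + r)) ^+ 2).
    by ring.
  rewrite t2.
  transitivity (x0%:~R ^+ 2 + r ^+ 2 * x1%:~R ^+ 2 + 2 * x0%:~R * x1%:~R * r
    + (2 - r) * ((x2%:~R + x3%:~R) ^+ 2 + x3%:~R ^+ 2 * r ^+ 2)
    + 2 * (x2%:~R + x3%:~R) * x3%:~R * (2 * r - r ^+ 2)); first by ring.
  by rewrite r2 !rmorphB !rmorphD !rmorphM /= ?rmorphD ?rmorphM /=; ring.
- by rewrite cth mulrN -expr2 th2 opprB.
move=> x0 x1 x2 x3 A2.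
have [t tE] : exists t, x0 = 2 * t.
  apply: (@even_of_sqr_even (x0 ^+ 2 + 2 * (x1 ^+ 2 + x2 ^+ 2 + x3 ^+ 2)
     - 2 * (x1 ^+ 2 + x2 ^+ 2 + x3 ^+ 2))); last by ring.
  by rewrite rpredB // dvdz_mulr.
(* The part without [th] is divisible because [2 t + x1 s = - th^2 (t + (x1 + t) (1 + s))]. *)
exists ((x2 + x3)%:~R + x3%:~R * s + (- t)%:~R * th + (- (x1 + t))%:~R * ((1 + s) * th)).
  by do 4!eexists.
rewrite tE !rmorphN !rmorphD !rmorphM /=.
move: s s2 th th2 {cth cf3 cs Zth Zs Zs1 Pa Ps Ps1} => r r2 u u2.
transitivity ((x2%:~R + x3%:~R + x3%:~R * r) * u
  - u ^+ 2 * (t%:~R + (x1%:~R + t%:~R) * (1 + r))); last by ring.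
rewrite u2; transitivity ((x2%:~R + x3%:~R + x3%:~R * r) * u + 2 * (x1%:~R + 2 * t%:~R)
  + r * x1%:~R - r ^+ 2 * (x1%:~R + t%:~R)); last by ring.
by rewrite r2; ring.
Qed.

End Cases.

(** * The first minimum and its comparison with Minkowski's bound *)

Theorem theorem2 (p n : nat) (z : algC) (P : algC -> Prop) (ap bp : nat) :
  prime p ->
  ((p %% 16 == 7)%N && (3 <= n)%N) || ((p %% 16 == 9)%N && (2 <= n)%N) ->
  (2 ^ n.+1)%N.-primitive_root z ->
  is_prime_ideal z P -> lies_over P p ->
  (0 < ap)%N -> (0 < bp)%N -> (ap ^ 2 = 2 * bp ^ 2 + p)%N ->
  (forall a b : nat, (0 < a)%N -> (0 < b)%N -> (a ^ 2 = 2 * b ^ 2 + p)%N ->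
     (ap <= a)%N) ->
  [/\ is_lambda1 (2 ^ n.+1) z P (sqrtC ((2 ^ n * ap)%N%:R : algC)),
      sqrtC ((2 ^ n * ap)%N%:R : algC) <= 4.-root ((2 ^ (2 * n + 1) * p)%N%:R : algC)
    & 4.-root ((2 ^ (2 * n + 1) * p)%N%:R : algC) < (2 ^ n)%N%:R * 4.-root (p%:R : algC)].
Proof.
move=> p_pr p_n z_prim Pprime Pover ap0 bp0 apbp ap_min.
have ap2 := minimal_le p_pr ap0 apbp ap_min.
have p0 := prime_gt0 p_pr.
have [n2 n3] : (2 <= n)%N /\ ((p %% 16 = 7)%N -> (3 <= n)%N).
  by move: p_n; clear; lia.
have p_mod : (p %% 16 = 7 \/ p %% 16 = 9)%N by move: p_n; clear; lia.
split; last 2 first.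
(* Taking fourth powers reduces this to [ap ^ 2 <= 2 * p]. *)
- rewrite -(@ler_pXn2r _ 4) ?nnegrE ?sqrtC_ge0 ?rootC_ge0 ?ler0n //.
  rewrite rootCK // (exprM _ 2 2) sqrtCK -natrX ler_nat.
  by rewrite expnMn expnD expn1 (mulnC 2 n) expnM -mulnA leq_pmul2l ?expn_gt0.
(* Taking fourth powers reduces this to [2 * n + 1 < 4 * n]. *)
- rewrite -(@ltr_pXn2r _ 4) ?nnegrE ?mulr_ge0 ?rootC_ge0 ?ler0n //.
  rewrite exprMn !rootCK // -natrX -natrM ltr_nat ltn_pmul2r // -expnM ltn_exp2l //.
  by move: n2; clear; lia.
(* Now [n] is [e + 2], so that [m = 8 * 2 ^ e] and [3 <= n] becomes [0 < e]. *)
case: n n2 n3 z_prim {p_n} => [|[|e]] // _ n3.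
have -> : (2 ^ e.+3 = 8 * 2 ^ e)%N by rewrite !expnS; clear; lia.
have -> : (2 ^ e.+2 = 4 * 2 ^ e)%N by rewrite !expnS; clear; lia.
move=> z_prim; have p_odd : odd p by move: p_mod; clear; lia.
have p7 : (7 <= p)%N by move: p_mod p0; clear; lia.
have M0 : (0 < 2 ^ e)%N by rewrite expn_gt0.
have emb_ge0 q : 0 <= emb_norm (8 * 2 ^ e) z q.
  by rewrite sqrtC_ge0 sumr_ge0 // => k _; exact: exprn_ge0.
have sqrt_emb q : emb_norm (8 * 2 ^ e) z q = sqrtC (emb_norm (8 * 2 ^ e) z q ^+ 2).
  by rewrite sqrCK.
split.
  have [y [C [D [Py yE C0 CD C2]]]] : exists y (C D : int), [/\ P y,
      y * y^* = C%:~R + D%:~R * (z ^+ (2 ^ e) - z ^+ (2 ^ e) ^+ 3), 0 < C,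
      C ^+ 2 - 2 * D ^+ 2 = p%:Z & C ^+ 2 <= 2 * p%:Z].
    case: p_mod => p16; last exact: short_9mod16.
    by apply: short_7mod16 => //; have := n3 p16.
  have Cap : C = ap%:Z.
    apply: (@pell_reduced_unique p C D ap%:Z bp%:Z) => //; move: apbp ap2; clear; lia.
  have y0 := ideal_form_neq0 z_prim yE C0.
  have [q yq] := ideal_inZz Pprime Py; rewrite {}yq in Py yE y0.
  exists q; split=> //; rewrite sqrt_emb; congr sqrtC.
  by have [-> _] := emb_norm_sqnorm z_prim yE; rewrite Cap [RHS]natrM.
move=> q Pq q0.
have [u pu] : exists u : int, p%:Z = 9 + 16 * u \/ - p%:Z = 9 + 16 * u.
  case: p_mod => p16; last by exists (p %/ 16)%N%:Z; left; move: p16; clear; lia.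
  by exists (- (p %/ 16)%N%:Z - 1); right; move: p16; clear; lia.
have [A [B [embA A0 N0 pN]]] := ideal_emb_norm z_prim p_pr p_odd Pprime Pover pu Pq q0.
rewrite sqrt_emb embA ler_sqrtC ?nnegrE ?mulr_ge0 ?ler0n ?ler0z ?(ltW A0) //.
rewrite [X in X <= _]natrM ler_pM2l ?ltr0n ?muln_gt0 // -[ap%:R]/(ap%:Z%:~R) ler_int.
exact: (minimal_norm_multiple p_pr ap0 apbp ap_min A0 N0 pN).
Qed.
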